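(* Consider the seven vector fields $$Z_1=\partial_x,\quad Z_2=x\,\partial_x,\quad Z_3=x^2\partial_x,\quad Z_4=\partial_u,\quad Z_5=u\,\partial_u,\quad Z_6=u^2\partial_u,\quad Z_7=\partial_t ,$$ where $x,t$ are independent variables and $u=u(x,t)$ is the dependent variable, and let $Z_j^{(7)}$ denote the seventh-order prolongation of $Z_j$. Applying the conditions $$Z_j^{(7)}\,\omega(x,t,u,u_t,u_x,u_{xx},u_{3x},u_{4x},u_{5x},u_{6x},u_{7x})=0,\qquad j=1,\dots,7,$$ one obtains the following four invariants for the seven-dimensional Lie algebra spanned by $Z_1,\dots,Z_7$: $$\omega_1=\frac{u_t^2}{u_x^2}\,S,$$ $$\omega_2=\frac{u_t^4}{u_x^4}\Big(S_{xx}-\frac54\frac{S_x^2}{S}+4S^2\Big),$$ $$\omega_3=\frac{u_t^5}{u_x^5}\Big(S_{3x}-\frac92\frac{S_xS_{xx}}{S}+\frac{15}{4}\frac{S_x^3}{S^2}\Big),$$ $$\omega_4=\frac{u_t^6}{u_x^6}\Big(S_{4x}-7\frac{S_xS_{3x}}{S}+\frac{63}{4}\frac{S_x^2S_{xx}}{S^2}+19SS_{xx}-\frac{315}{32}\frac{S_x^4}{S^3}-\frac{95}{4}S_x^2+34S^3\Big),$$ where $S=\dfrac{u_{3x}}{u_x}-\dfrac32\dfrac{u_{xx}^2}{u_x^2}$. The most general PDE, with functional dependence on $x,t,u,u_t,u_x,u_{xx},u_{3x},\dots,u_{7x}$ as indicated above, that is invariant under the transformation group with generators $Z_1,\dots,Z_7$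 is of the form $$\Psi(\omega_1,\omega_2,\omega_3,\omega_4)=0$$ for any given function $\Psi$.
   Context: Subscripts denote partial derivatives, with $u_{px}=\partial^p u/\partial x^p$. $S$ is the Schwarzian derivative of $u$ with respect to $x$, and $S_x,S_{xx},S_{3x},S_{4x}$ are its $x$-derivatives. The vector fields $Z_1,\dots,Z_7$ are the Lie generators of the group of transformations $u\mapsto(\alpha_1u+\beta_1)/(\alpha_2u+\beta_2)$, $x\mapsto(\gamma_1x+\delta_1)/(\gamma_2x+\delta_2)$, $t\mapsto t+\epsilon$, with real parameters, $\alpha_1\beta_2-\alpha_2\beta_1=1$ and $\gamma_1\delta_2-\gamma_2\delta_1=1$. Prolongation of a vector field is the usual one from Lie symmetry theory.
   Formalization: That every invariant PDE is Ψ(ω1,…,ω4)=0 is proved where u_x, u_t and S are nonzero, with one Ψ for each connected component (fixed signs of u_x, u_t, S); it fails otherwise, e.g. for u_t²+(S_xx−(5/4)S_x²/S)²=0 or (u_t/u_x)√|S|=1. *)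

(* Defs.v *)
From HB Require Import structures.
From mathcomp Require Import all_boot all_order all_algebra.
From mathcomp Require Import all_classical all_reals all_analysis.
Set Implicit Arguments.
Unset Strict Implicit.
Unset Printing Implicit Defensive.
Import Order.TTheory GRing.Theory Num.Theory.
Import numFieldNormedType.Exports.
Local Open Scope classical_set_scope.
Local Open Scope ring_scope.

(* [ju z p q] is the coordinate u_{px,qt}; [ju z 0 0] is u itself.  All orders
   are kept so that total differentiation stays inside one type; every
   operator below involves only finitely many coordinates. *)
Record jet (R : Type) := Jet { jx : R; jt : R; ju : nat -> nat -> R }.

Section Jets.
Context {R : realType}.
Implicit Types (f : jet R -> R) (z : jet R) (p q n : nat).

Definition set_jx z s : jet R := Jet s (jt z) (ju z).
Definition set_jt z s : jet R := Jet (jx z) s (ju z).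
Definition set_ju z p q s : jet R :=
  Jet (jx z) (jt z)
    (fun p' q' => if (p' == p) && (q' == q) then s else ju z p' q').

Definition pd_x f z : R := derive1 (fun s => f (set_jx z s)) (jx z).
Definition pd_t f z : R := derive1 (fun s => f (set_jt z s)) (jt z).
Definition pd_u p q f z : R := derive1 (fun s => f (set_ju z p q s)) (ju z p q).

(* Total derivatives of a differential function of order at most [n], i.e. one
   depending on x, t and the u_{px,qt} with p + q <= n only. *)
Definition Dx n f z : R :=
  pd_x f z +
  \sum_(p < n.+1) \sum_(q < n.+1 | (p + q <= n)%N)
     ju z p.+1 q * pd_u p q f z.
Definition Dt n f z : R :=
  pd_t f z +
  \sum_(p < n.+1) \sum_(q < n.+1 | (p + q <= n)%N)
     ju z p q.+1 * pd_u p q f z.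

(* xi(x,t,u) d/dx + tau(x,t,u) d/dt + phi(x,t,u) d/du *)
Record vfield := VField {
  vf_x : R -> R -> R -> R;
  vf_t : R -> R -> R -> R;
  vf_u : R -> R -> R -> R }.

Definition at_jet (a : R -> R -> R -> R) : jet R -> R :=
  fun z => a (jx z) (jt z) (ju z 0 0).

(* phi^{J,k} = D_k phi^J - (D_k xi) u_{J,x} - (D_k tau) u_{J,t}; the multi-index
   (p,q) is reached by p steps in x followed by q steps in t. *)
Fixpoint pr_coef_x (Z : vfield) p : jet R -> R :=
  match p with
  | 0 => at_jet (vf_u Z)
  | p'.+1 => fun z =>
      Dx p' (pr_coef_x Z p') z
      - Dx 0 (at_jet (vf_x Z)) z * ju z p'.+1 0
      - Dx 0 (at_jet (vf_t Z)) z * ju z p' 1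
  end.

Fixpoint pr_coef (Z : vfield) p q : jet R -> R :=
  match q with
  | 0 => pr_coef_x Z p
  | q'.+1 => fun z =>
      Dt (p + q') (pr_coef Z p q') z
      - Dt 0 (at_jet (vf_x Z)) z * ju z p.+1 q'
      - Dt 0 (at_jet (vf_t Z)) z * ju z p q'.+1
  end.

Definition prolong n (Z : vfield) f z : R :=
  at_jet (vf_x Z) z * pd_x f z + at_jet (vf_t Z) z * pd_t f z +
  \sum_(p < n.+1) \sum_(q < n.+1 | (p + q <= n)%N)
     pr_coef Z p q z * pd_u p q f z.

Definition Zgen (j : 'I_7) : vfield :=
  tnth [tuple
    VField (fun x t u => 1)      (fun x t u => 0) (fun x t u => 0);
    VField (fun x t u => x)      (fun x t u => 0) (fun x t u => 0);
    VField (fun x t u => x ^+ 2) (fun x t u => 0) (fun x t u => 0);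
    VField (fun x t u => 0)      (fun x t u => 0) (fun x t u => 1);
    VField (fun x t u => 0)      (fun x t u => 0) (fun x t u => u);
    VField (fun x t u => 0)      (fun x t u => 0) (fun x t u => u ^+ 2);
    VField (fun x t u => 0)      (fun x t u => 1) (fun x t u => 0)] j.

(* (x, t, u, u_t, u_x, u_xx, u_3x, ..., u_7x) *)
Definition jcoord z : 'rV[R]_11 :=
  \row_(i < 11) nth 0
    [:: jx z, jt z, ju z 0 0, ju z 0 1 & [seq ju z k 0 | k <- iota 1 7]] i.

Definition schwarzian z : R :=
  ju z 3 0 / ju z 1 0 - 3 / 2 * (ju z 2 0 ^+ 2 / ju z 1 0 ^+ 2).

(* S_{kx}; it has order k + 3. *)
Fixpoint schw k : jet R -> R :=
  match k with
  | 0 => schwarzian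
  | k'.+1 => Dx (k' + 3) (schw k')
  end.

Definition omega1 z : R := ju z 0 1 ^+ 2 / ju z 1 0 ^+ 2 * schw 0 z.

Definition omega2 z : R :=
  ju z 0 1 ^+ 4 / ju z 1 0 ^+ 4 *
  (schw 2 z - 5 / 4 * (schw 1 z ^+ 2 / schw 0 z) + 4 * schw 0 z ^+ 2).

Definition omega3 z : R :=
  ju z 0 1 ^+ 5 / ju z 1 0 ^+ 5 *
  (schw 3 z - 9 / 2 * (schw 1 z * schw 2 z / schw 0 z)
   + 15 / 4 * (schw 1 z ^+ 3 / schw 0 z ^+ 2)).

Definition omega4 z : R :=
  ju z 0 1 ^+ 6 / ju z 1 0 ^+ 6 *
  (schw 4 z - 7 * (schw 1 z * schw 3 z / schw 0 z)
   + 63 / 4 * (schw 1 z ^+ 2 * schw 2 z / schw 0 z ^+ 2)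
   + 19 * (schw 0 z * schw 2 z)
   - 315 / 32 * (schw 1 z ^+ 4 / schw 0 z ^+ 3)
   - 95 / 4 * schw 1 z ^+ 2
   + 34 * schw 0 z ^+ 3).

Definition omega z : 'rV[R]_4 :=
  \row_(i < 4) nth 0 [:: omega1 z; omega2 z; omega3 z; omega4 z] i.

(* Where the formulas for the omega's make sense. *)
Definition omega_dom : set (jet R) :=
  [set z | ju z 1 0 != 0 /\ schwarzian z != 0].

(* Where, in addition, the omega's are functionally independent: their
   differentials degenerate on u_t = 0. *)
Definition regular : set (jet R) := omega_dom `&` [set z | ju z 0 1 != 0].

(* The connected component of [z0] in [regular].  The signs of u_x and u_t are
   unchanged by the connected group under consideration but are not functions
   of the omega's, so a single function of the omega's can only be expected
   on one component at a time. *)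
Definition component (z0 : jet R) : set (jet R) :=
  [set z | [/\ 0 < ju z0 1 0 * ju z 1 0,
               0 < ju z0 0 1 * ju z 0 1 &
               0 < schwarzian z0 * schwarzian z]].

(* Linear independence at [z] of the differentials of the components of [w]. *)
Definition differentials_free m (w : jet R -> 'rV[R]_m) z : Prop :=
  forall c : 'I_m -> R,
    \sum_i c i * pd_x (fun y => w y 0 i) z = 0 ->
    \sum_i c i * pd_t (fun y => w y 0 i) z = 0 ->
    (forall p q, \sum_i c i * pd_u p q (fun y => w y 0 i) z = 0) ->
    forall i, c i = 0.

End Jets.

Section Group.
Context {R : realType}.
Implicit Types (u : (R * R)%type -> R) (P : (R * R)%type).

Definition dpx u P : R := 'D_((1, 0) : (R * R)%type) u P.
Definition dpt u P : R := 'D_((0, 1) : (R * R)%type) u P.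

Fixpoint class_C n (U : set (R * R)%type) u : Prop :=
  match n with
  | 0 => forall P, U P -> {for P, continuous u}
  | n'.+1 => [/\ forall P, U P -> differentiable u P,
                 class_C n' U (dpx u) & class_C n' U (dpt u)]
  end.

Definition smooth_near u P : Prop :=
  exists U : set (R * R)%type, [/\ open U, U P & forall n, class_C n U u].

Definition jet_of u P : jet R :=
  Jet P.1 P.2 (fun p q => iter p dpx (iter q dpt u) P).

Definition mobius (a b c d y : R) : R := (a * y + b) / (c * y + d).

Record transf := Transf {
  al1 : R; be1 : R; al2 : R; be2 : R;
  ga1 : R; de1 : R; ga2 : R; de2 : R;
  eps : R;
  det_u : al1 * be2 - al2 * be1 = 1;
  det_x : ga1 * de2 - ga2 * de1 = 1 }.

Definition act_point (g : transf) P : (R * R)%type :=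
  (mobius (ga1 g) (de1 g) (ga2 g) (de2 g) P.1, P.2 + eps g).

(* The function whose graph is the image of the graph of [u]: the inverse of
   x |-> (ga1 x + de1) / (ga2 x + de2) is x |-> (de2 x - de1) / (ga1 - ga2 x). *)
Definition act_fun (g : transf) u : (R * R)%type -> R := fun P =>
  mobius (al1 g) (be1 g) (al2 g) (be2 g)
    (u (mobius (de2 g) (- de1 g) (- ga2 g) (ga1 g) P.1, P.2 - eps g)).

(* The equation F = 0, considered on the set [D] of jets, is invariant: its
   locus is stable under the prolonged group action, which sends the jet of
   [u] at [P] to the jet of the transformed function at the transformed
   point.  The group is a local one, whence the two nonvanishing
   denominators. *)
Definition invariant_pde (D : set (jet R)) (F : jet R -> R) : Prop :=
  forall (g : transf) u P,
    smooth_near u P ->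
    ga2 g * P.1 + de2 g != 0 ->
    al2 g * u P + be2 g != 0 ->
    D (jet_of u P) ->
    F (jet_of u P) = 0 ->
    F (jet_of (act_fun g u) (act_point g P)) = 0.

End Group.

(* Main.v *)
Require Import Defs.
From HB Require Import structures.
From mathcomp Require Import all_boot all_order all_algebra.
From mathcomp Require Import all_classical all_reals all_analysis.
From mathcomp Require Import ring lra zify.
Set Implicit Arguments.
Unset Strict Implicit.
Unset Printing Implicit Defensive.
Import Order.TTheory GRing.Theory Num.Theory.
Import numFieldNormedType.Exports.
Local Open Scope classical_set_scope.
Local Open Scope ring_scope.

(* Put [q i = u_{ix} / u_x] and [r = u_t / u_x].  The total derivative acts by
   [D_x (q i) = q i.+1 - q 2 * q i], so every [S_{kx}] is a polynomial in the [q i]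
   in which [q (k + 3)] occurs linearly.  Hence
   (x, t, u, u_x, u_xx, S_x, r, omega_1, ..., omega_4) are coordinates on the
   regular jets, with an explicit inverse.  The [omega_i] are killed by the seven
   prolonged fields, and a triangular computation shows that the fields span the
   first seven coordinate directions at every regular jet.  A function killed by
   them is therefore constant along the first seven coordinates, and since a
   component is a product of lines and half-lines in these coordinates, it is a
   function of the [omega_i], obtained by restriction to a slice.

   A finite transformation acts by [S |-> w^4 S] with [w = ga2 x + de2] the square
   root of dx/dx'; differentiating repeatedly gives its action on the [S_{kx}] and
   the invariance of the [omega_i].  Conversely the group acts transitively on the
   first seven coordinates within a component, and any jet is that of a polynomial
   function, so an invariant equation only depends on the [omega_i]. *)

(** * Differentials *)

(** The first seven coordinates are matched with the generators: [Z_1], [Z_7], [Z_4] translate [x],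
    [t], [u]; [Z_5] scales [u_x]; [Z_6] at [u = 0] moves [u_xx] by [2 u_x^2]; [Z_3] at [x = 0] moves
    [S_x] by [-4 S]; [Z_2] scales [r]. These factors are nonzero exactly where [u_x], [S] and [u_t]
    do not vanish. The infinitesimal and the finite statements need separate arguments. An invariant
    equation [F = 0] merely has a stable zero set: [F] may be neither differentiable nor constant on
    orbits, so the seven conditions say nothing about it. Integrating the fields is therefore
    replaced by an explicit group element joining two jets; and since the finite action is defined
    on functions, the jets must be realized by functions. A jet carries infinitely many coordinates,
    so all differentiation is transported to ['rV_11]. *)

Section HasDiff.
Context {R : realType} {V : normedModType R}.
Implicit Types (f g : V -> R) (x v : V) (L M : V -> R).

(** Differentiability bundled with an explicit formula for the differential. [L] is a plain
    function, so the rules below build it by unification and [has_diff_eq] then simplifies it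
    pointwise. *)
Definition has_diff f x L := differentiable f x /\ forall v, 'd f x v = L v.

Lemma has_diff_eq f x L M : has_diff f x L -> (forall v, L v = M v) ->
  has_diff f x M.
Proof. by move=> [df dL] LM; split=> // v; rewrite dL. Qed.

Lemma has_diff_unique f x L M : has_diff f x L -> has_diff f x M ->
  forall v, L v = M v.
Proof. by move=> [_ dL] [_ dM] v; rewrite -dL -dM. Qed.

Lemma has_diff_cst (c : R) x : has_diff (fun _ => c) x (fun _ => 0).
Proof.
split; first exact: differentiable_cst.
by move=> v; rewrite (diff_cst c x).
Qed.

Lemma has_diffD f g x L M : has_diff f x L -> has_diff g x M ->
  has_diff (fun y => f y + g y) x (fun v => L v + M v).
Proof.
move=> [df dL] [dg dM]; split; first exact: differentiableD.
by move=> v; rewrite (diffD df dg) -dL -dM.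
Qed.

Lemma has_diffN f x L : has_diff f x L ->
  has_diff (fun y => - f y) x (fun v => - L v).
Proof.
move=> [df dL]; split; first exact: differentiableN.
by move=> v; rewrite (diffN df) -dL.
Qed.

Lemma has_diffM f g x L M : has_diff f x L -> has_diff g x M ->
  has_diff (fun y => f y * g y) x (fun v => L v * g x + f x * M v).
Proof.
move=> [df dL] [dg dM]; split; first exact: differentiableM.
move=> v; rewrite (diffM df dg) -dL -dM [LHS]addrC; congr (_ + _).
exact: mulrC.
Qed.

Lemma has_diffV f x L : f x != 0 -> has_diff f x L ->
  has_diff (fun y => (f y)^-1) x (fun v => - L v / f x ^+ 2).
Proof.
move=> fx [df dL]; split; first exact: differentiableV.
move=> v; rewrite (diffV df fx) -dL [RHS]mulrC mulrN -mulNr.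
by [].
Qed.

Lemma has_diffX f x L n : has_diff f x L ->
  has_diff (fun y => f y ^+ n) x (fun v => n%:R * f x ^+ n.-1 * L v).
Proof.
case: n => [|n] [df dL].
  apply: (@has_diff_eq _ _ (fun=> 0)); last by move=> v; rewrite !mul0r.
  rewrite (_ : (fun y => _) = fun=> 1); first exact: has_diff_cst.
  by apply/funext => y; rewrite expr0.
rewrite (_ : (fun y => _) = f ^+ n.+1); last by rewrite exprfctE.
split; first exact: differentiableX.
by move=> v; rewrite (diffX _ df) -dL.
Qed.

Lemma has_diff_near0 f x : (\forall y \near x, f y = 0) ->
  has_diff f x (fun=> 0).
Proof.
move=> f0.
have f0' : \forall y \near (0 : V), f (y + x) = 0.
  by move: f0; rewrite (near_shift 0) subr0.
have E : f \o shift x = cst (f x) + 'd (cst (0 : R)) x +o_ 0 id.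
  rewrite (diff_cst (0 : R) x) (nbhs_singleton f0).
  apply/eqaddoP => e e0; near=> y.
  rewrite !fctE /= (near f0' y) // !addr0 subr0 normr0.
  by rewrite mulr_ge0 // ltW.
have C : continuous ('d (cst (0 : R)) x : V -> R).
  by apply: diff_continuous; exact: differentiable_cst.
have D := diff_unique C E.
split; last by move=> v; rewrite D (diff_cst (0 : R) x).
by apply/diff_locallyP; rewrite D.
Unshelve. all: by end_near. Qed.

(** [g = f + (g - f)], and [g - f] vanishes near [x], hence has zero differential there. *)
Lemma has_diff_near f g x L : (\forall y \near x, f y = g y) ->
  has_diff f x L -> has_diff g x L.
Proof.
move=> fg df.
have d0 : has_diff (fun y => g y - f y) x (fun=> 0).
  apply: has_diff_near0; near=> y; rewrite (near fg y) ?subrr//.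
have := has_diffD df d0.
rewrite (_ : (fun y => _) = g); last by apply/funext => y; rewrite addrC subrK.
by move=> h; apply: has_diff_eq h _ => v; rewrite addr0.
Unshelve. all: by end_near. Qed.

Lemma has_diff_neq0 f x L : has_diff f x L -> f x != 0 ->
  \forall y \near x, f y != 0.
Proof.
move=> [df _] fx; have cf : f @ x --> f x by exact: differentiable_continuous.
apply: (cf [set t | t != 0]).
by apply: open_nbhs_nbhs; split; first exact: open_neq.
Qed.

End HasDiff.

Lemma has_diff_comp (R : realType) (V W : normedModType R) (f : V -> W)
  (g : W -> R) x L : differentiable f x -> has_diff g (f x) L ->
  has_diff (fun y => g (f y)) x (fun v => L ('d f x v)).
Proof.
move=> df [dg dL]; split; first exact: (differentiable_comp df dg).
by move=> v; rewrite (diff_comp df dg) /= dL.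
Qed.

Lemma has_diff_coord (R : realType) n (y : 'rV[R]_n) i :
  has_diff (fun z : 'rV[R]_n => z 0 i) y (fun v => v 0 i).
Proof.
split; first exact: differentiable_coord.
move=> v.
have @f : {linear 'rV[R]_n -> R}.
  by exists (fun N : 'rV[R]_n => N 0 i); do 2![eexists]; do ?[constructor];
     rewrite ?mxE// => ? *; rewrite ?mxE//; move=> ?; rewrite !mxE.
rewrite (_ : (fun _ => _) = f) //; rewrite diff_lin //.
exact: coord_continuous.
Qed.

Lemma has_diff1 (R : realType) (f : R -> R) (x d : R) :
  is_derive x 1 f d <-> has_diff f x (fun h => h * d).
Proof.
split=> [[df fd]|[df dL]].
  split; first exact/derivable1_diffP.
  by move=> h; rewrite (deriv1E df) derive1E fd.
split; first exact/derivable1_diffP.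
rewrite (deriveE _ df) dL mul1r //.
Qed.

Ltac solve_has_diff := repeat first [ eassumption | apply: has_diff_cst
  | apply: has_diffV | apply: has_diffD | apply: has_diffN 
  | apply: has_diffM | apply: has_diffX ].

(** * Jets and total derivatives *)

Definition co {R : ringType} {n} (k : nat) (y : 'rV[R]_n.+1) : R := y 0 (inord k).

Definition rv {R : ringType} {n} (s : seq R) : 'rV[R]_n := \row_i nth 0 s i.

Lemma co_rv (R : ringType) n k (s : seq R) : (k <= n)%N ->
  co k (rv s : 'rV_n.+1) = nth 0 s k.
Proof. by move=> kn; rewrite /co mxE inordK. Qed.

Lemma rowP_co (R : ringType) n (y z : 'rV[R]_n.+1) :
  (forall k, (k <= n)%N -> co k y = co k z) -> y = z.
Proof.
move=> yz; apply/rowP => i; have := yz i.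
by rewrite /co inord_val -ltnS ltn_ord => ->.
Qed.

Lemma has_diff_co (R : realType) n k (y : 'rV[R]_n.+1) :
  has_diff (co k) y (co k).
Proof. exact: has_diff_coord. Qed.

Section JetCalculus.
Context {R : realType}.
Implicit Types (z : jet R) (f : jet R -> R) (y : 'rV[R]_11).

Definition jcoord_seq z : seq R :=
  [:: jx z; jt z; ju z 0 0; ju z 0 1; ju z 1 0; ju z 2 0; ju z 3 0; ju z 4 0;
      ju z 5 0; ju z 6 0; ju z 7 0].

Lemma jcoordE z : jcoord z = rv (jcoord_seq z).
Proof. by []. Qed.

Lemma co_jcoord k z : (k <= 10)%N -> co k (jcoord z) = nth 0 (jcoord_seq z) k.
Proof. by rewrite jcoordE; exact: co_rv. Qed.

(** A tangent vector with components [a] along [x], [b] along [t] and [c p q] along [u_{px,qt}], as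
    seen in the eleven coordinates. *)
Definition djet (a b : R) (c : nat -> nat -> R) : 'rV[R]_11 := jcoord (Jet a b c).

Definition delta (p q p' q' : nat) : R := ((p' == p) && (q' == q))%:R.

Lemma jcoord_set_jx z s :
  jcoord (set_jx z s) = jcoord z + (s - jx z) *: djet 1 0 (fun _ _ => 0).
Proof.
apply/rowP => -[i hi]; rewrite !mxE /=.
by do 11?[case: i hi => [|i] hi; rewrite /= ?nth_nil; try ring].
Qed.

Lemma jcoord_set_jt z s :
  jcoord (set_jt z s) = jcoord z + (s - jt z) *: djet 0 1 (fun _ _ => 0).
Proof.
apply/rowP => -[i hi]; rewrite !mxE /=.
by do 11?[case: i hi => [|i] hi; rewrite /= ?nth_nil; try ring].
Qed.

Lemma jcoord_set_ju z p q s : jcoord (set_ju z p q s) =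
  jcoord z + (s - ju z p q) *: djet 0 0 (delta p q).
Proof.
have E p' q' : ju (set_ju z p q s) p' q' =
    ju z p' q' + (s - ju z p q) * delta p q p' q'.
  rewrite /delta /=; case: ifP => [/andP[/eqP-> /eqP->]|_]; rewrite /=; ring.
apply/rowP => -[i hi]; rewrite !mxE.
by do 11?[case: i hi => [|i] hi; rewrite /= -?E ?nth_nil //=; try ring].
Qed.

(* Differential functions such as [schw] are given by a formula in [jcoord] only
   where [u_x] does not vanish, hence the restriction to a neighbourhood. *)
Definition represents (E : 'rV[R]_11 -> R) f z :=
  \forall y \near jcoord z, forall z', jcoord z' = y -> f z' = E y.

(** The line through [y] with direction [v] stays in the given neighbourhood for [s] near [s0],
    where [g] is [E] along the line; so [derive1 g s0] is a directional derivative of [E]. *)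
Lemma derive1_line (E : 'rV[R]_11 -> R) y v (g : R -> R) (s0 : R) L :
  has_diff E y L ->
  (\forall y' \near y, forall s, y' = y + (s - s0) *: v -> g s = E y') ->
  derive1 g s0 = L v.
Proof.
move=> [dE dL] near_g; rewrite -dL -(deriveE _ dE) derive1E.
have gE : \forall h \near (0 : R), g (h + s0) = E (h *: v + y).
  have c : (fun h : R => y + h *: v) @ (0 : R) --> y.
    rewrite -[X in _ --> X]addr0 -(scale0r v).
    by apply: cvgD; [exact: cvg_cst|apply: cvgZr_tmp; exact: cvg_id].
  have := c _ near_g; rewrite nbhs_simpl /= => h0.
  near=> h; rewrite [h *: v + y]addrC; apply: (near h0 h) => //.
  by rewrite addrK.
rewrite /derive; congr (lim _).
have E0 : \forall h \near (0 : R)^',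
   h^-1 *: ((g \o shift s0) (h *: 1) - g s0)
   = h^-1 *: ((E \o shift y) (h *: v) - E y).
  have := nbhs_singleton gE; rewrite scale0r !add0r => gs0.
  apply: cvg_within; near=> h.
  by rewrite /= [h *: 1]mulr1 gs0 (near gE h).
rewrite eqEsubset; split; apply/near_eq_cvg => //.
by near=> h; apply/esym; near: h.
Unshelve. all: by end_near. Qed.

Lemma represents_everywhere (E : 'rV[R]_11 -> R) f z :
  (forall z', f z' = E (jcoord z')) -> represents E f z.
Proof. by move=> fE; near=> y => z' <-. Unshelve. all: by end_near. Qed.

Lemma pd_x_represents E f z L : has_diff E (jcoord z) L -> represents E f z ->
  pd_x f z = L (djet 1 0 (fun _ _ => 0)).
Proof.
move=> dE fE; apply: (derive1_line dE); move: fE; apply: filterS => y fE s ys.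
by apply: fE; rewrite jcoord_set_jx.
Qed.

Lemma pd_t_represents E f z L : has_diff E (jcoord z) L -> represents E f z ->
  pd_t f z = L (djet 0 1 (fun _ _ => 0)).
Proof.
move=> dE fE; apply: (derive1_line dE); move: fE; apply: filterS => y fE s ys.
by apply: fE; rewrite jcoord_set_jt.
Qed.

Lemma pd_u_represents E f z p q L : has_diff E (jcoord z) L ->
  represents E f z -> pd_u p q f z = L (djet 0 0 (delta p q)).
Proof.
move=> dE fE; apply: (derive1_line dE); move: fE; apply: filterS => y fE s ys.
by apply: fE; rewrite jcoord_set_ju.
Qed.

Lemma djetD a b c a' b' c' : djet (a + a') (b + b') (fun p q => c p q + c' p q)
  = djet a b c + djet a' b' c'.
Proof.
apply/rowP => -[i hi]; rewrite !mxE /=.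
by do 11?[case: i hi => [|i] hi; rewrite /= ?nth_nil ?addr0].
Qed.

Lemma djetZ k a b c :
  djet (k * a) (k * b) (fun p q => k * c p q) = k *: djet a b c.
Proof.
apply/rowP => -[i hi]; rewrite !mxE /=.
by do 11?[case: i hi => [|i] hi; rewrite /= ?nth_nil ?mulr0].
Qed.

Definition truncated n (c : nat -> nat -> R) p q :=
  if (p + q <= n)%N then c p q else 0.

(** An entry reads at most one component [c p q], so at each entry the double sum of [djet_sum] has
    at most one nonzero term. *)
Lemma djet_entry (i : 'I_11) : (forall c, djet 0 0 c 0 i = 0) \/
  exists p q, forall c, djet 0 0 c 0 i = c p q.
Proof.
case: i => i hi.
case: i hi => [|i] hi; first by left=> c; rewrite !mxE.
case: i hi => [|i] hi; first by left=> c; rewrite !mxE.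
right; case: i hi => [|i] hi; first by exists 0, 0 => c; rewrite !mxE.
case: i hi => [|i] hi; first by exists 0, 1 => c; rewrite !mxE.
by do 7?[case: i hi => [|i] hi; [by eexists _, 0 => c; rewrite !mxE|]].
Qed.

Lemma djet_sum n c : djet 0 0 (truncated n c) =
  \sum_(p < n.+1) \sum_(q < n.+1 | (p + q <= n)%N) c p q *: djet 0 0 (delta p q).
Proof.
apply/rowP => i; rewrite summxE.
under eq_bigr => p _ do
  (rewrite summxE; under eq_bigr => q _ do rewrite mxE).
have [E|[p' [q' E]]] := djet_entry i.
  rewrite E big1 // => p _; rewrite big1 // => q _.
  by rewrite E mulr0.
rewrite E; under eq_bigr => p _ do under eq_bigr => q _ do rewrite E.
rewrite /truncated; case: ifPn => pq; last first.
  rewrite big1 // => p _; rewrite big1 // => q pq'.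
  rewrite /delta; case: andP => [[/eqP pp /eqP qq]|_]; last by rewrite mulr0.
  by move: pq; rewrite pp qq pq'.
have p'n : (p' < n.+1)%N by lia.
have q'n : (q' < n.+1)%N by lia.
rewrite (bigD1 (Ordinal p'n)) //= (bigD1 (Ordinal q'n)) //=.
rewrite {1}/delta !eqxx mulr1 !big1 ?addr0 //.
- move=> p; rewrite -val_eqE /= eq_sym => /negPf pp; rewrite big1 // => q _.
  by rewrite /delta pp mulr0.
- move=> q /andP[_]; rewrite -val_eqE /= eq_sym => /negPf qq.
  by rewrite /delta qq andbF mulr0.
Qed.

(** Common form of [Dx], [Dt] and [prolong]: each applies a vector, cut off at order [n], to [f],
    and this is the differential of [E] at that vector. *)
Lemma represents_vector E f z L n a b (c : nat -> nat -> R) : has_diff E (jcoord z) L ->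
  represents E f z ->
  a * pd_x f z + b * pd_t f z +
    \sum_(p < n.+1) \sum_(q < n.+1 | (p + q <= n)%N) c p q * pd_u p q f z
  = L (djet a b (truncated n c)).
Proof.
move=> dE fE; rewrite (pd_x_represents dE fE) (pd_t_represents dE fE).
under eq_bigr => p _ do under eq_bigr => q _ do rewrite (pd_u_represents _ _ dE fE).
have -> : djet a b (truncated n c) = a *: djet 1 0 (fun _ _ => 0) +
    b *: djet 0 1 (fun _ _ => 0) + djet 0 0 (truncated n c).
  rewrite -!djetZ -!djetD; congr djet; rewrite ?mulr1 ?mulr0 ?addr0 ?add0r //.
  by apply/funext => p; apply/funext => q; rewrite add0r.
rewrite djet_sum; case: dE => _ dL.
under eq_bigr => p _ do under eq_bigr => q _ do rewrite -dL.
rewrite -!dL !linearD !linearZ /= linear_sum; congr (_ + _).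
apply: eq_bigr => p _; rewrite linear_sum; apply: eq_bigr => q _.
by rewrite linearZ.
Qed.

Lemma Dx_represents E f z L n : has_diff E (jcoord z) L -> represents E f z ->
  Dx n f z = L (djet 1 0 (truncated n (fun p q => ju z p.+1 q))).
Proof.
move=> dE fE; rewrite -(represents_vector _ _ _ _ dE fE).
by rewrite mul1r mul0r addr0.
Qed.

Lemma Dt_represents E f z L n : has_diff E (jcoord z) L -> represents E f z ->
  Dt n f z = L (djet 0 1 (truncated n (fun p q => ju z p q.+1))).
Proof.
move=> dE fE; rewrite -(represents_vector _ _ _ _ dE fE).
by rewrite mul0r mul1r add0r.
Qed.

Lemma prolong_represents E f z L n Z : has_diff E (jcoord z) L ->
  represents E f z -> prolong n Z f z =
  L (djet (at_jet (vf_x Z) z) (at_jet (vf_t Z) z)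
       (truncated n (fun p q => pr_coef Z p q z))).
Proof. by move=> dE fE; rewrite -(represents_vector _ _ _ _ dE fE). Qed.

End JetCalculus.

(** * The Schwarzian and its total derivatives *)

Section Schwarzian.
Context {R : realType}.

(* [S_{kx}] in terms of the quotients [q i = u_{ix} / u_x]: since
   [D_x (q i) = q i.+1 - q 2 * q i], each entry is obtained from the previous
   one by this substitution rule.  The last entry is [S_{4x}]. *)
Definition sch (k : nat) (q : nat -> R) : R :=
  match k with
  | 0 => q 3%N - 3 / 2 * q 2%N ^+ 2
  | 1 => q 4%N - 4 * (q 2%N * q 3%N) + 3 * q 2%N ^+ 3
  | 2 => q 5%N - 5 * (q 2%N * q 4%N) - 4 * q 3%N ^+ 2 + 17 * (q 2%N ^+ 2 * q 3%N)
         - 9 * q 2%N ^+ 4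
  | 3 => q 6%N - 6 * (q 2%N * q 5%N) - 13 * (q 3%N * q 4%N) + 27 * (q 2%N ^+ 2 * q 4%N)
         + 42 * (q 2%N * q 3%N ^+ 2) - 87 * (q 2%N ^+ 3 * q 3%N) + 36 * q 2%N ^+ 5
  | _ => q 7%N - 7 * (q 2%N * q 6%N) - 19 * (q 3%N * q 5%N) + 39 * (q 2%N ^+ 2 * q 5%N)
         - 13 * q 4%N ^+ 2 + 164 * (q 2%N * (q 3%N * q 4%N)) - 168 * (q 2%N ^+ 3 * q 4%N)
         + 42 * q 3%N ^+ 3 - 387 * (q 2%N ^+ 2 * q 3%N ^+ 2)
         + 528 * (q 2%N ^+ 4 * q 3%N) - 180 * q 2%N ^+ 6
  end.

Definition dsch (k : nat) (q d : nat -> R) : R :=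
  match k with
  | 0 => d 3%N - 3 * (q 2%N * d 2%N)
  | 1 => d 4%N - 4 * (d 2%N * q 3%N + q 2%N * d 3%N) + 9 * (q 2%N ^+ 2 * d 2%N)
  | 2 => d 5%N - 5 * (d 2%N * q 4%N + q 2%N * d 4%N) - 8 * (q 3%N * d 3%N)
         + 17 * (2 * q 2%N * d 2%N * q 3%N + q 2%N ^+ 2 * d 3%N) - 36 * (q 2%N ^+ 3 * d 2%N)
  | 3 => d 6%N - 6 * (d 2%N * q 5%N + q 2%N * d 5%N) - 13 * (d 3%N * q 4%N + q 3%N * d 4%N)
         + 27 * (2 * q 2%N * d 2%N * q 4%N + q 2%N ^+ 2 * d 4%N)
         + 42 * (d 2%N * q 3%N ^+ 2 + 2 * q 2%N * q 3%N * d 3%N)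
         - 87 * (3 * q 2%N ^+ 2 * d 2%N * q 3%N + q 2%N ^+ 3 * d 3%N)
         + 180 * (q 2%N ^+ 4 * d 2%N)
  | _ => d 7%N - 7 * (d 2%N * q 6%N + q 2%N * d 6%N) - 19 * (d 3%N * q 5%N + q 3%N * d 5%N)
         + 39 * (2 * q 2%N * d 2%N * q 5%N + q 2%N ^+ 2 * d 5%N) - 26 * (q 4%N * d 4%N)
         + 164 * (d 2%N * q 3%N * q 4%N + q 2%N * d 3%N * q 4%N + q 2%N * q 3%N * d 4%N)
         - 168 * (3 * q 2%N ^+ 2 * d 2%N * q 4%N + q 2%N ^+ 3 * d 4%N)
         + 126 * (q 3%N ^+ 2 * d 3%N)
         - 774 * (q 2%N * d 2%N * q 3%N ^+ 2 + q 2%N ^+ 2 * q 3%N * d 3%N)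
         + 528 * (4 * q 2%N ^+ 3 * d 2%N * q 3%N + q 2%N ^+ 4 * d 3%N)
         - 1080 * (q 2%N ^+ 5 * d 2%N)
  end.

Lemma has_diff_sch (V : normedModType R) k (q dq : nat -> V -> R) x :
  (forall i, (i <= 7)%N -> has_diff (q i) x (dq i)) ->
  has_diff (fun y => sch k (fun i => q i y)) x
    (fun v => dsch k (fun i => q i x) (fun i => dq i v)).
Proof.
by move=> dqP; case: k => [|[|[|[|k]]]] /=; (apply: has_diff_eq;
  [solve_has_diff; by apply: dqP | move=> v /=; field]).
Qed.

Definition qs (y : 'rV[R]_11) (i : nat) : R := co (3 + i) y / co 4 y.

Definition dqs (y v : 'rV[R]_11) (i : nat) : R :=
  (co (3 + i) v - qs y i * co 4 v) / co 4 y.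

Lemma has_diff_qs y i : co 4 y != 0 ->
  has_diff (fun y => qs y i) y (fun v => dqs y v i).
Proof.
move=> y4; apply: has_diff_eq.
  apply: has_diffM; first exact: has_diff_co.
  apply: has_diffV => //; exact: has_diff_co.
by move=> v /=; rewrite /dqs /qs; field.
Qed.

Lemma has_diff_Sy k y : co 4 y != 0 ->
  has_diff (fun y => sch k (qs y)) y (fun v => dsch k (qs y) (dqs y v)).
Proof.
move=> y4; have := @has_diff_sch _ k (fun i y => qs y i)
  (fun i v => dqs y v i) y (fun i _ => has_diff_qs i y4).
by [].
Qed.

Lemma near_co_neq0 n k (y : 'rV[R]_n.+1) : co k y != 0 ->
  \forall y' \near y, co k y' != 0.
Proof. exact: has_diff_neq0 (has_diff_co k y). Qed.

Lemma co4_jcoord (z : jet R) : co 4 (jcoord z) = ju z 1 0.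
Proof. by rewrite co_jcoord. Qed.

(** The formula for [S_{kx}] holds on a neighbourhood, where [u_x] stays nonzero, so it may be
    differentiated to reach [k.+1]. Cutting [Dx] at order [k + 3] loses nothing, as [sch k] involves
    [q i] only for [i <= k + 3]; the bound [k <= 4] keeps the order within the seven of [jcoord]. *)
Lemma schwE k (z : jet R) : (k <= 4)%N -> ju z 1 0 != 0 ->
  schw k z = sch k (qs (jcoord z)).
Proof.
elim: k z => [|k IH] z k4 z1.
  by rewrite /= /schwarzian /qs !co_jcoord //= expr_div_n; field.
have z4 : co 4 (jcoord z) != 0 by rewrite co4_jcoord.
have rep : represents (fun y => sch k (qs y)) (schw k) z.
  have := near_co_neq0 z4; apply: filterS => y y4 z' zy.
  by rewrite IH ?zy //; [lia|rewrite -co4_jcoord zy].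
rewrite /= (Dx_represents _ (has_diff_Sy k z4) rep) {rep IH}.
case: k k4 => [|[|[|[|//]]]] _; rewrite /= /dqs /qs /djet !co_jcoord //= /truncated /=;
  by field.
Qed.

End Schwarzian.

(** * The prolonged generators *)

Section Prolongation.
Context {R : realType}.
Implicit Types (z : jet R) (n p : nat).

Definition field_x n : @vfield R :=
  VField (fun x _ _ => x ^+ n) (fun _ _ _ => 0) (fun _ _ _ => 0).
Definition field_u n : @vfield R :=
  VField (fun _ _ _ => 0) (fun _ _ _ => 0) (fun _ _ u => u ^+ n).
Definition field_t : @vfield R :=
  VField (fun _ _ _ => 0) (fun _ _ _ => 1) (fun _ _ _ => 0).

Lemma Zgen_cases (P : vfield -> Prop) :
  (forall n, (n <= 2)%N -> P (field_x n)) ->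
  (forall n, (n <= 2)%N -> P (field_u n)) -> P field_t ->
  forall j, P (Zgen j).
Proof.
move=> PX PU PT [j hj].
case: j hj => [|[|[|[|[|[|[|//]]]]]]] hj;
  [exact: PX 0 _ | exact: PX 1 _ | exact: PX 2 _
  |exact: PU 0 _ | exact: PU 1 _ | exact: PU 2 _ | exact: PT].
Qed.

Lemma Dx0_at_x n z : Dx 0 (at_jet (fun x _ _ => x ^+ n)) z =
  n%:R * jx z ^+ n.-1.
Proof.
have dE := has_diffX n (has_diff_co 0 (jcoord z)).
rewrite (Dx_represents 0 dE).
  by rewrite /djet !co_jcoord //= mulr1.
by apply: represents_everywhere => z'; rewrite co_jcoord.
Qed.

Lemma Dt0_at_x n z : Dt 0 (at_jet (fun x _ _ => x ^+ n)) z = 0.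
Proof.
have dE := has_diffX n (has_diff_co 0 (jcoord z)).
rewrite (Dt_represents 0 dE).
  by rewrite /djet !co_jcoord //= mulr0.
by apply: represents_everywhere => z'; rewrite co_jcoord.
Qed.

Lemma Dt0_at_u n z : Dt 0 (at_jet (fun _ _ u => u ^+ n)) z =
  n%:R * ju z 0 0 ^+ n.-1 * ju z 0 1.
Proof.
have dE := has_diffX n (has_diff_co 2 (jcoord z)).
rewrite (Dt_represents 0 dE).
  by rewrite /djet !co_jcoord.
by apply: represents_everywhere => z'; rewrite co_jcoord.
Qed.

Lemma Dx_cst n (c : R) z : Dx n (fun _ => c) z = 0.
Proof.
rewrite (Dx_represents n (has_diff_cst c (jcoord z))) //.
exact: represents_everywhere.
Qed.

Lemma Dt_cst n (c : R) z : Dt n (fun _ => c) z = 0.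
Proof.
rewrite (Dt_represents n (has_diff_cst c (jcoord z))) //.
exact: represents_everywhere.
Qed.

(** The prolongation coefficient [D_x^p (- xi u_x) + xi u_{(p+1)x}] for [xi = x^n]. By the Leibniz
    rule only [xi'] and [xi''] survive when [n <= 2], and then
    ['C(p, 2) xi'' = p (p - 1) 'C(n, 2)]. *)
Definition coef_x n (x : R) (a : nat -> R) p : R :=
  - ((p * n)%:R * x ^+ n.-1 * a p + (p * p.-1 * 'C(n, 2))%:R * a p.-1).

(* [D_x^p (u^n)] for [n <= 2] and [p <= 7], with [a i = u_{ix}]. *)
Definition coef_u n (a : nat -> R) p : R :=
  match n with
  | 0 => if p is 0 then 1 else 0
  | 1 => a p
  | _ => match p with
    | 0 => a 0%N ^+ 2
    | 1 => 2 * (a 0%N * a 1%N)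
    | 2 => 2 * (a 0%N * a 2%N) + 2 * a 1%N ^+ 2
    | 3 => 2 * (a 0%N * a 3%N) + 6 * (a 1%N * a 2%N)
    | 4 => 2 * (a 0%N * a 4%N) + 8 * (a 1%N * a 3%N) + 6 * a 2%N ^+ 2
    | 5 => 2 * (a 0%N * a 5%N) + 10 * (a 1%N * a 4%N) + 20 * (a 2%N * a 3%N)
    | 6 => 2 * (a 0%N * a 6%N) + 12 * (a 1%N * a 5%N) + 30 * (a 2%N * a 4%N)
           + 20 * a 3%N ^+ 2
    | _ => 2 * (a 0%N * a 7%N) + 14 * (a 1%N * a 6%N) + 42 * (a 2%N * a 5%N)
           + 70 * (a 3%N * a 4%N)
    end
  end.

(* The index of [u_{px}] in [jcoord]. *)
Definition xidx p := if p is 0 then 2 else (3 + p)%N.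

Lemma pr_coef_field_x n p z : (n <= 2)%N -> (p <= 7)%N ->
  pr_coef_x (field_x n) p z = coef_x n (jx z) (fun i => ju z i 0) p.
Proof.
move=> n2; elim: p z => [|p IH] z p7.
  by rewrite /= /coef_x /at_jet /= !mul0n !mul0r addr0 oppr0.
pose E (y : 'rV[R]_11) := coef_x n (co 0 y) (fun i => co (xidx i) y) p.
have rep : represents E (pr_coef_x (field_x n) p) z.
  apply: represents_everywhere => z'; rewrite (IH _ (ltnW p7)) /E /coef_x.
  clear IH E; by do 7?[case: p p7 => [|p] p7; [by rewrite !co_jcoord|]].
have dE : has_diff E (jcoord z) (fun v =>
    - ((p * n)%:R * (n.-1%:R * co 0 (jcoord z) ^+ n.-2 * co 0 v
         * co (xidx p) (jcoord z) + co 0 (jcoord z) ^+ n.-1 * co (xidx p) v)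
       + (p * p.-1 * 'C(n, 2))%:R * co (xidx p.-1) v)).
  apply: has_diff_eq.
    apply: has_diffN; apply: has_diffD; apply: has_diffM;
      last exact: has_diff_co; last exact: has_diff_cst; 
      last exact: has_diff_co; apply: has_diffM; first exact: has_diff_cst.
    exact/has_diffX/has_diff_co.
  by move=> v /=; ring.
rewrite /= (Dx_represents p dE rep) Dx0_at_x Dx_cst mul0r subr0.
rewrite /coef_x /djet.
case: n n2 {IH E rep dE} => [|[|[|//]]] _;
do 7?[case: p p7 => [|p] p7; [by rewrite !co_jcoord //= /truncated /= ?binE /=; ring|]].
all: by [].
Qed.

Lemma pr_coef_field_u n p z : (n <= 2)%N -> (p <= 7)%N ->
  pr_coef_x (field_u n) p z = coef_u n (fun i => ju z i 0) p.
Proof.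
move=> n2; elim: p z => [|p IH] z p7.
  by rewrite /= /at_jet /coef_u; case: n n2 => [|[|[|]]].
pose E (y : 'rV[R]_11) := coef_u n (fun i => co (xidx i) y) p.
have rep : represents E (pr_coef_x (field_u n) p) z.
  apply: represents_everywhere => z'; rewrite (IH _ (ltnW p7)) /E /coef_u.
  clear IH E; case: n n2 => [|[|[|//]]] _;
  by do 7?[case: p p7 => [|p] p7; [by rewrite ?co_jcoord|]].
rewrite /= !Dx_cst !mul0r !subr0.
clear IH.
case: n n2 @E rep => [|[|[|//]]] _ E rep;
(do 7?[case: p p7 @E rep => [|p] p7 E rep; [
  (eapply etrans; [apply: (Dx_represents _ _ rep); rewrite /E /=;
    solve_has_diff; exact: has_diff_co |
  by rewrite /djet ?co_jcoord //= /truncated /= ?co_jcoord //=; ring])|]]).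
all: by [].
Qed.

Lemma pr_coef_field_t p z : pr_coef_x field_t p z = 0.
Proof.
elim: p z => [|p IH] z //=.
rewrite !Dx_cst !mul0r !subr0 (_ : pr_coef_x _ p = fun=> 0) ?Dx_cst //.
by apply/funext => z'; rewrite IH.
Qed.

Lemma coef_x0 n x a : coef_x n x a 0%N = 0.
Proof. by rewrite /coef_x !mul0n !mul0r addr0 oppr0. Qed.

Lemma coef_u0 n a : (n <= 2)%N -> coef_u n a 0%N = a 0%N ^+ n.
Proof. by case: n => [|[|[|]]]. Qed.

Lemma pr_coef_ut_x n z : pr_coef (field_x n) 0 1 z = 0.
Proof. by rewrite /= Dt0_at_x !Dt_cst !mul0r !subr0. Qed.

Lemma pr_coef_ut_u n z :
  pr_coef (field_u n) 0 1 z = n%:R * ju z 0 0 ^+ n.-1 * ju z 0 1.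
Proof. by rewrite /= Dt0_at_u !Dt_cst !mul0r !subr0. Qed.

Lemma pr_coef_ut_t z : pr_coef field_t 0 1 z = 0.
Proof. by rewrite /= !Dt_cst !mul0r !subr0. Qed.

(* The prolonged fields as tangent vectors in the coordinates [jcoord]. *)
Definition zeta_x n z : 'rV[R]_11 :=
  rv [:: jx z ^+ n, 0, 0, 0 &
      [seq coef_x n (jx z) (fun i => ju z i 0) p | p <- iota 1 7]].
Definition zeta_u n z : 'rV[R]_11 :=
  rv [:: 0, 0, ju z 0 0 ^+ n, n%:R * ju z 0 0 ^+ n.-1 * ju z 0 1 &
      [seq coef_u n (fun i => ju z i 0) p | p <- iota 1 7]].
Definition zeta_t : 'rV[R]_11 := rv [:: 0; 1].

(** A function of [jcoord] sees, among the [t]-derivatives of [u], only [u_t]; so the coefficients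
    along [u_{px}] and [u_t] determine the tangent vector. *)
Lemma prolong_field_x n E f z L : (n <= 2)%N -> has_diff E (jcoord z) L ->
  represents E f z -> prolong 7 (field_x n) f z = L (zeta_x n z).
Proof.
move=> n2 dE fE; rewrite (prolong_represents _ _ dE fE); congr (L _).
have c01 := pr_coef_ut_x n z.
have c0 p : (p <= 7)%N -> pr_coef (field_x n) p 0 z = _ := pr_coef_field_x z n2.
apply: rowP_co => k k10; rewrite /djet co_jcoord // co_rv //.
move: (pr_coef _) c01 c0 => c c01 c0.
by do 11?[case: k k10 => [|k] k10; [rewrite //= /truncated /= ?c01 ?c0 ?coef_x0 ?coef_u0|]].
Qed.

Lemma prolong_field_u n E f z L : (n <= 2)%N -> has_diff E (jcoord z) L ->
  represents E f z -> prolong 7 (field_u n) f z = L (zeta_u n z).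
Proof.
move=> n2 dE fE; rewrite (prolong_represents _ _ dE fE); congr (L _).
have c01 := pr_coef_ut_u n z.
have c0 p : (p <= 7)%N -> pr_coef (field_u n) p 0 z = _ := pr_coef_field_u z n2.
apply: rowP_co => k k10; rewrite /djet co_jcoord // co_rv //.
move: (pr_coef _) c01 c0 => c c01 c0.
by do 11?[case: k k10 => [|k] k10; [rewrite //= /truncated /= ?c01 ?c0 ?coef_x0 ?coef_u0|]].
Qed.

Lemma prolong_field_t E f z L : has_diff E (jcoord z) L ->
  represents E f z -> prolong 7 field_t f z = L zeta_t.
Proof.
move=> dE fE; rewrite (prolong_represents _ _ dE fE); congr (L _).
have c01 := pr_coef_ut_t z.
have c0 p : pr_coef field_t p 0 z = _ := pr_coef_field_t p z.
apply: rowP_co => k k10; rewrite /djet co_jcoord // co_rv //.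
move: (pr_coef _) c01 c0 => c c01 c0.
by do 11?[case: k k10 => [|k] k10; [rewrite //= /truncated /= ?c01 ?c0 ?coef_x0 ?coef_u0|]].
Qed.

End Prolongation.

(** * The invariants *)

Section Omega.
Context {R : realType}.

(* [omega_{i+1}] is [r ^+ om_weight i * om_base i S] with [r = u_t / u_x] and
   [S k = S_{kx}]. *)
Definition om_base (i : nat) (S : nat -> R) : R :=
  match i with
  | 0 => S 0%N
  | 1 => S 2%N - 5 / 4 * (S 1%N ^+ 2 / S 0%N) + 4 * S 0%N ^+ 2
  | 2 => S 3%N - 9 / 2 * (S 1%N * S 2%N / S 0%N) + 15 / 4 * (S 1%N ^+ 3 / S 0%N ^+ 2)
  | _ => S 4%N - 7 * (S 1%N * S 3%N / S 0%N)
         + 63 / 4 * (S 1%N ^+ 2 * S 2%N / S 0%N ^+ 2)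
         + 19 * (S 0%N * S 2%N) - 315 / 32 * (S 1%N ^+ 4 / S 0%N ^+ 3)
         - 95 / 4 * S 1%N ^+ 2 + 34 * S 0%N ^+ 3
  end.

(** The default [6] is the weight of [omega_4]: as in [om_base], every index from 3 on denotes that
    invariant. *)
Definition om_weight (i : nat) := nth 6%N [:: 2; 4; 5]%N i.

Definition om (i : nat) (r : R) (S : nat -> R) := r ^+ om_weight i * om_base i S.

Definition d_om_base (i : nat) (S d : nat -> R) : R :=
  match i with
  | 0 => d 0%N
  | 1 => d 2%N - 5 / 4 * (2 * S 1%N * d 1%N / S 0%N - S 1%N ^+ 2 * d 0%N / S 0%N ^+ 2)
         + 8 * (S 0%N * d 0%N)
  | 2 => d 3%N - 9 / 2 * ((d 1%N * S 2%N + S 1%N * d 2%N) / S 0%N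
                        - S 1%N * S 2%N * d 0%N / S 0%N ^+ 2)
         + 15 / 4 * (3 * S 1%N ^+ 2 * d 1%N / S 0%N ^+ 2
                     - 2 * S 1%N ^+ 3 * d 0%N / S 0%N ^+ 3)
  | _ => d 4%N - 7 * ((d 1%N * S 3%N + S 1%N * d 3%N) / S 0%N
                        - S 1%N * S 3%N * d 0%N / S 0%N ^+ 2)
         + 63 / 4 * ((2 * S 1%N * d 1%N * S 2%N + S 1%N ^+ 2 * d 2%N) / S 0%N ^+ 2
                     - 2 * S 1%N ^+ 2 * S 2%N * d 0%N / S 0%N ^+ 3)
         + 19 * (d 0%N * S 2%N + S 0%N * d 2%N)
         - 315 / 32 * (4 * S 1%N ^+ 3 * d 1%N / S 0%N ^+ 3
                       - 3 * S 1%N ^+ 4 * d 0%N / S 0%N ^+ 4)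
         - 95 / 2 * (S 1%N * d 1%N) + 102 * (S 0%N ^+ 2 * d 0%N)
  end.

Definition d_om (i : nat) (r : R) (S : nat -> R) (dr : R) (d : nat -> R) : R :=
  (om_weight i)%:R * r ^+ (om_weight i).-1 * dr * om_base i S
  + r ^+ om_weight i * d_om_base i S d.

Lemma has_diff_om_base (V : normedModType R) i (S dS : nat -> V -> R) x :
  S 0%N x != 0 -> (forall k, has_diff (S k) x (dS k)) ->
  has_diff (fun y => om_base i (fun k => S k y)) x
    (fun v => d_om_base i (fun k => S k x) (fun k => dS k v)).
Proof.
move=> S0 dSP; have S0n n : S 0%N x ^+ n != 0 by rewrite expf_neq0.
by case: i => [|[|[|i]]] /=; (apply: has_diff_eq;
  [solve_has_diff => //; exact: dSP | move=> v /=; field]).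
Qed.

Lemma has_diff_om (V : normedModType R) i (r dr : V -> R)
    (S dS : nat -> V -> R) x :
  S 0%N x != 0 -> has_diff r x dr -> (forall k, has_diff (S k) x (dS k)) ->
  has_diff (fun y => om i (r y) (fun k => S k y)) x
    (fun v => d_om i (r x) (fun k => S k x) (dr v) (fun k => dS k v)).
Proof.
move=> S0 rP dSP; apply: has_diffM; last exact: has_diff_om_base.
exact: has_diffX.
Qed.

(* The infinitesimal changes of [r = u_t / u_x] and of the [S_{kx}] under a
   projective change of [x]. *)
Lemma d_om_projective i (r l m : R) (S : nat -> R) : S 0%N != 0 ->
  d_om i r S (l * r)
    (fun k => - (l * k.+2%:R * S k + m * (k * (k + 3))%:R * S k.-1)) = 0.
Proof.
(* Giving [S_{kx}] weight [k + 2] makes [om_base i] homogeneous of weight [om_weight i], so the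
   [l]-terms cancel against the power of [r]. The rational coefficients cancel the [m]-terms: in
   [omega_2], [S_xx] contributes [-10 m S_x] and [-5/4 S_x^2 / S] contributes [+10 m S_x]. *)
move=> S0; case: i => [|[|[|i]]]; rewrite /d_om /om_weight /= ?nth_nil.
all: by field.
Qed.

(** Here [l = xi'] and [m = xi'' / 2]; dividing by [u_x] lowers the weight of [q i] to [i - 1]. As
    [l' = 2 m], each total derivative adds [2 (k + 2)] to the coefficient of [m S_{(k-1)x}], whence
    [k (k + 3)], which also kills the term with [k.-1] at [k = 0]. *)
Lemma dsch_projective k (q : nat -> R) (l m : R) : q 1%N = 1 -> (k <= 4)%N ->
  dsch k q (fun i => - (l * i.-1%:R * q i + m * (i * i.-1)%:R * q i.-1)) =
  - (l * k.+2%:R * sch k q + m * (k * (k + 3))%:R * sch k.-1 q).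
Proof.
by move=> q1; case: k => [|[|[|[|[|//]]]]] _ /=; rewrite ?q1; field.
Qed.

(** The infinitesimal Moebius invariance of the Schwarzian in [u]. The terms of [u^2 d/du]
    containing [u] itself cancel in the quotients [q i], hence the value 0 at [j = 0]; what remains
    is [l = u_x] times an expression in the [q j]. *)
Lemma dsch_u2 k (q : nat -> R) l : q 1%N = 1 -> (k <= 4)%N ->
  dsch k q (fun i => l * (coef_u 2 (fun j => if j is 0 then 0 else q j) i)) = 0.
Proof.
by move=> q1; case: k => [|[|[|[|[|//]]]]] _ /=; rewrite ?q1; field.
Qed.

Lemma eq_dsch k (q d d' : nat -> R) :
  (k <= 4)%N -> (forall i, (2 <= i <= k + 3)%N -> d i = d' i) ->
  dsch k q d = dsch k q d'.
Proof.
by move=> + dd'; case: k dd' => [|[|[|[|[|//]]]]] dd' _ /=; rewrite !dd'.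
Qed.

Lemma eq_d_om i r S dr (d d' : nat -> R) :
  (forall k, (k <= 4)%N -> d k = d' k) -> d_om i r S dr d = d_om i r S dr d'.
Proof.
by move=> dd'; rewrite /d_om; congr (_ + _ * _);
  case: i => [|[|[|i]]] /=; rewrite !dd'.
Qed.

(* [rr], [SS], [Om] are [u_t / u_x], [S_{kx}] and [omega_{i+1}] in the coordinates
   [jcoord]; [drr], [dSS], [dOm] are their differentials. *)
Definition rr (y : 'rV[R]_11) : R := co 3 y / co 4 y.
Definition drr (y v : 'rV[R]_11) : R := (co 3 v - rr y * co 4 v) / co 4 y.
Definition SS (y : 'rV[R]_11) (k : nat) : R := sch k (qs y).
Definition dSS (y v : 'rV[R]_11) (k : nat) : R := dsch k (qs y) (dqs y v).

Lemma has_diff_rr (y : 'rV[R]_11) : co 4 y != 0 -> has_diff rr y (drr y).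
Proof.
move=> y4; apply: has_diff_eq.
  apply: has_diffM; first exact: has_diff_co.
  apply: has_diffV => //; exact: has_diff_co.
by move=> v /=; rewrite /drr /rr; field.
Qed.

Definition Om i (y : 'rV[R]_11) := om i (rr y) (SS y).
Definition dOm i (y v : 'rV[R]_11) := d_om i (rr y) (SS y) (drr y v) (dSS y v).

Lemma has_diff_Om i (y : 'rV[R]_11) : co 4 y != 0 -> SS y 0 != 0 -> has_diff (Om i) y (dOm i y).
Proof.
move=> y4 S0; apply: (@has_diff_om _ i rr (drr y) (fun k y => SS y k)
  (fun k v => dSS y v k)) => //; first exact: has_diff_rr.
by move=> k; exact: has_diff_Sy.
Qed.

Lemma qs1 (y : 'rV[R]_11) : co 4 y != 0 -> qs y 1 = 1.
Proof. by move=> y4; rewrite /qs divff. Qed.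

Section Fields.
Variable z : jet R.
Let y := jcoord z.
Hypothesis z1 : ju z 1 0 != 0.

Let y4 : co 4 y != 0. Proof. by rewrite co4_jcoord. Qed.

Lemma dSS_zeta_x n k : (k <= 4)%N -> dSS y (zeta_x n z) k =
  - (n%:R * jx z ^+ n.-1 * k.+2%:R * SS y k
     + 'C(n, 2)%:R * (k * (k + 3))%:R * SS y k.-1).
Proof.
move=> k4; rewrite /SS -dsch_projective ?qs1 //; apply: eq_dsch => // i ik.
rewrite /dqs /qs /y !co_rv; try lia.
have {k k4 ik} : (2 <= i <= 7)%N by lia.
do 2?[case: i => [|i]; first by []].
by do 6?[case: i => [|i]; first by rewrite /coef_x /= => _; field].
Qed.

Lemma drr_zeta_x n : drr y (zeta_x n z) = n%:R * jx z ^+ n.-1 * rr y.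
Proof.
by rewrite /drr /rr /y !co_rv //= /coef_x /=; field.
Qed.

Lemma dSS_zeta_u n k : (n <= 2)%N -> (k <= 4)%N -> dSS y (zeta_u n z) k = 0.
Proof.
move=> n2 k4.
rewrite -(@dsch_u2 k (qs y) ((n == 2)%:R * ju z 1 0)) ?qs1 //.
apply: eq_dsch => // i ik.
rewrite /dqs /qs /y !co_rv; try lia.
have {k k4 ik} : (2 <= i <= 7)%N by lia.
case: n n2 => [|[|[|//]]] _; (do 2?[case: i => [|i]; first by []];
 by do 6?[case: i => [|i]; first by rewrite /= ?co_jcoord //= => _; field]).
Qed.

Lemma drr_zeta_u n : (n <= 2)%N -> drr y (zeta_u n z) = 0.
Proof.
move=> n2; rewrite /drr /rr /y !co_rv //=.
by case: n n2 => [|[|[|//]]] _ /=; field.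
Qed.

Lemma drr_zeta_t : drr y zeta_t = 0.
Proof. by rewrite /drr !co_rv //= mulr0 subr0 mul0r. Qed.

Lemma dSS_zeta_t k : (k <= 4)%N -> dSS y zeta_t k = 0.
Proof.
move=> k4; rewrite /dSS (@eq_dsch _ _ _ (fun=> 0)) //.
  by case: k k4 => [|[|[|[|[|//]]]]] _ /=; ring.
move=> i ik; rewrite /dqs !co_rv //=; last lia.
by rewrite mulr0 subr0; case: i {ik} => [|i] /=; rewrite ?nth_nil mul0r.
Qed.

Lemma d_om0 i r (S : nat -> R) : d_om i r S 0 (fun=> 0) = 0.
Proof. by rewrite /d_om; case: i => [|[|[|i]]] /=; ring. Qed.

Hypothesis z0 : SS y 0 != 0.

Lemma dOm_zeta_x i n : dOm i y (zeta_x n z) = 0.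
Proof.
rewrite /dOm (eq_d_om _ _ _ _ (@dSS_zeta_x n)) drr_zeta_x.
exact: d_om_projective.
Qed.

Lemma dOm_zeta_u i n : (n <= 2)%N -> dOm i y (zeta_u n z) = 0.
Proof.
move=> n2; rewrite /dOm (@eq_d_om _ _ _ _ _ (fun=> 0)).
  by rewrite drr_zeta_u // d_om0.
by move=> k; exact: dSS_zeta_u.
Qed.

Lemma dOm_zeta_t i : dOm i y zeta_t = 0.
Proof.
rewrite /dOm (@eq_d_om _ _ _ _ _ (fun=> 0)).
  by rewrite drr_zeta_t d_om0.
exact: dSS_zeta_t.
Qed.

End Fields.

Lemma omega_domP (z : jet R) :
  omega_dom z <-> ju z 1 0 != 0 /\ SS (jcoord z) 0 != 0.
Proof.
have E : ju z 1 0 != 0 -> schwarzian z = SS (jcoord z) 0 := @schwE _ 0 z isT.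
by split=> -[z1]; rewrite /omega_dom /= E.
Qed.

Lemma omegaE (z : jet R) (i : 'I_4) : ju z 1 0 != 0 ->
  omega z 0 i = Om i (jcoord z).
Proof.
move=> z1; rewrite mxE /Om /om /rr /SS !co_jcoord // !expr_div_n.
have E k : (k <= 4)%N -> sch k (qs (jcoord z)) = schw k z.
  by move=> k4; rewrite schwE.
by case: i => [[|[|[|[|//]]]] i4] /=;
  rewrite /omega1 /omega2 /omega3 /omega4 -?(E 0%N) -?(E 1%N) -?(E 2%N)
    -?(E 3%N) -?(E 4%N).
Qed.

Lemma omega_represents (z : jet R) (i : 'I_4) : ju z 1 0 != 0 ->
  represents (Om i) (fun z => omega z 0 i) z.
Proof.
move=> z1; have z4 : co 4 (jcoord z) != 0 by rewrite co4_jcoord.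
have := near_co_neq0 z4; apply: filterS => y y4 z' zy.
by rewrite omegaE ?zy // -co4_jcoord zy.
Qed.

Lemma prolong_omega (j : 'I_7) (i : 'I_4) (z : jet R) : omega_dom z ->
  prolong 7 (Zgen j) (fun y => omega y 0 i) z = 0.
Proof.
move=> /omega_domP [z1 S0].
have z4 : co 4 (jcoord z) != 0 by rewrite co4_jcoord.
have dO := has_diff_Om i z4 S0.
have rO := omega_represents i z1.
apply: (Zgen_cases (P := fun Z => prolong 7 Z (fun y => omega y 0 i) z = 0)) => [n n2|n n2|].
- by rewrite (prolong_field_x n2 dO rO) dOm_zeta_x.
- by rewrite (prolong_field_u n2 dO rO) dOm_zeta_u.
- by rewrite (prolong_field_t dO rO) dOm_zeta_t.
Qed.

End Omega.

Arguments SS : simpl never.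
Arguments dSS : simpl never.

(** * Functional independence of the invariants *)

Section Free.
Context {R : realType}.

(** A triangular system: [u_7x] occurs in [omega_4] only, [u_6x] in no earlier one than [omega_3],
    [u_5x] in no earlier one than [omega_2], each linearly through the top derivative of [S]. The
    last coefficient is found along [u_t], where [omega_1] has derivative [2 r S / u_x]. *)
Lemma differentials_free_omega (z : jet R) :
  regular z -> differentials_free omega z.
Proof.
move=> [/omega_domP [z1 S0] /= ut0] c _ _ cu.
have z4 : co 4 (jcoord z) != 0 by rewrite co4_jcoord.
have {cu} h p q : \sum_i c i * dOm i (jcoord z) (djet 0 0 (delta p q)) = 0.
  rewrite -[RHS](cu p q); apply: eq_bigr => i _.
  by rewrite (pd_u_represents _ _ (has_diff_Om i z4 S0) (omega_represents i z1)).
have r0 : rr (jcoord z) != 0.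
  by rewrite /rr !co_jcoord //= mulf_neq0 ?invr_neq0.
have dS p k : (4 <= p <= 7)%N -> (k + 3 <= p)%N ->
    dSS (jcoord z) (djet 0 0 (delta p 0)) k = (k + 3 == p)%:R / ju z 1 0.
  move=> p7 kp; rewrite /dSS /dqs /djet.
  have {p7} pE : p = 4%N \/ p = 5%N \/ p = 6%N \/ p = 7%N by lia.
  have k4 : (k <= 4)%N by lia.
  case: k k4 kp => [|[|[|[|[|//]]]]] _ kp /=; rewrite !co_jcoord //=;
  by move: kp; case: pE => [|[|[|]]] -> kp; rewrite /delta /=; first [by []|field].
have dr p : (4 <= p)%N -> drr (jcoord z) (djet 0 0 (delta p 0)) = 0.
  by move: p => [|[|p]] // _; rewrite /drr /djet !co_jcoord //= !mulr0 subr0 mul0r.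
have dO p i : (4 <= p)%N -> dOm i (jcoord z) (djet 0 0 (delta p 0)) =
    rr (jcoord z) ^+ om_weight i *
      d_om_base i (SS (jcoord z)) (dSS (jcoord z) (djet 0 0 (delta p 0))).
  by move=> p4; rewrite /dOm /d_om dr // mulr0 mul0r add0r.
have sum4 (F : 'I_4 -> R) : \sum_i F i =
    F (inord 0) + F (inord 1) + F (inord 2) + F (inord 3).
  rewrite !big_ord_recl big_ord0 addr0 !addrA.
  by do 3?[congr (_ + _)]; congr F; apply: val_inj; rewrite /= inordK.
have V : (ju z 1 0)^-1 != 0 by rewrite invr_eq0.
have aux (a r v : R) n : r != 0 -> v != 0 -> a * (r ^+ n * v) = 0 -> a = 0.
  move=> rn0 vn0 /eqP.
  by rewrite mulf_eq0 mulf_eq0 expf_eq0 (negPf rn0) (negPf vn0) andbF !orbF => /eqP.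
have c3 : c (inord 3) = 0.
  have := h 7%N 0%N; rewrite sum4 !inordK // !dO // /= !dS //=.
  rewrite !(mul0r, mulr0, add0r, addr0, oppr0, mul1r); exact: aux.
have c2 : c (inord 2) = 0.
  have := h 6%N 0%N; rewrite sum4 !inordK // !dO // /= c3 mul0r !dS //=.
  rewrite !(mul0r, mulr0, add0r, addr0, oppr0, mul1r); exact: aux.
have c1 : c (inord 1) = 0.
  have := h 5%N 0%N; rewrite sum4 !inordK // !dO // /= c3 c2 !mul0r !dS //=.
  rewrite !(mul0r, mulr0, add0r, addr0, oppr0, mul1r); exact: aux.
have c0 : c (inord 0) = 0.
  have := h 0%N 1%N; rewrite sum4 c3 c2 c1 !inordK // !mul0r !addr0.
  rewrite /dOm /d_om (_ : drr _ _ = (ju z 1 0)^-1); last first.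
    by rewrite /drr /djet !co_jcoord //= mulr0 subr0 mul1r.
  rewrite /om_weight /= (_ : dSS _ _ _ = 0); last first.
    by rewrite /dSS /dqs /djet /= !co_jcoord //= /delta /= !(mulr0, subr0, mul0r).
  rewrite mulr0 addr0 => E; apply: (aux _ _ (2 * SS (jcoord z) 0) 1 r0).
    by rewrite mulf_neq0 ?pnatr_eq0.
  apply: (mulIf V); rewrite mul0r -[RHS]E; ring.
move=> i; rewrite -[i]inord_val.
by case: i => [[|[|[|[|//]]]] i4].
Qed.
End Free.

(** * Straightening the orbits *)

Section Chart.
Context {R : realType}.
Implicit Types y c : 'rV[R]_11.

Lemma differentiable_rowP (V : normedModType R) n (f : V -> 'rV[R]_n) (x : V) :
  (forall i, differentiable (fun v : V => f v 0 i) x) -> differentiable f x.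
Proof.
move=> df; rewrite (_ : f = \sum_(i < n) (fun v => f v 0 i *: delta_mx 0 i)).
  by apply: differentiable_sum => i; exact: differentiableZl.
by apply/funext => v; rewrite fct_sumE [LHS]row_sum_delta.
Qed.

(* In these coordinates the component of a regular jet is a product of lines and
   half-lines, and the seven generators span the first seven directions. *)
Definition chart_seq y : seq R :=
  [:: co 0 y; co 1 y; co 2 y; co 4 y; co 5 y; SS y 1; rr y;
      Om 0 y; Om 1 y; Om 2 y; Om 3 y].
Definition dchart_seq y v : seq R :=
  [:: co 0 v; co 1 v; co 2 v; co 4 v; co 5 v; dSS y v 1; drr y v;
      dOm 0 y v; dOm 1 y v; dOm 2 y v; dOm 3 y v].
Definition chart y : 'rV[R]_11 := rv (chart_seq y).

Definition jreg y := [/\ co 4 y != 0, co 3 y != 0 & SS y 0 != 0].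

Lemma has_diff_chart y k : jreg y -> (k <= 10)%N ->
  has_diff (fun y => co k (chart y)) y (fun v => nth 0 (dchart_seq y v) k).
Proof.
move=> [y4 y3 S0] k10; rewrite (_ : (fun y => _) = fun y => nth 0 (chart_seq y) k).
  by do 11?[case: k k10 => [|k] k10; [first
    [exact: has_diff_co|exact: has_diff_rr|exact: has_diff_Sy|exact: has_diff_Om]|]].
by apply/funext => y'; rewrite co_rv.
Qed.

Lemma differentiable_chart y : jreg y -> differentiable chart y.
Proof.
move=> yr; apply: differentiable_rowP => i.
have := (has_diff_chart yr (_ : i <= 10)%N).1; rewrite /co inord_val; apply.
by rewrite -ltnS.
Qed.

Lemma diff_chart y v : jreg y -> 'd chart y v = rv (dchart_seq y v).
Proof.
move=> yr; apply: rowP_co => k k10; rewrite co_rv //.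
have h := has_diff_comp (differentiable_chart yr) (has_diff_co k (chart y)).
exact: has_diff_unique h (has_diff_chart yr k10) v.
Qed.

(** [S_x] is a coordinate; each of [S], [S_xx], [S_3x], [S_4x] occurs linearly in its own [omega],
    which is solved for it in turn. *)
Definition chart_S (c : 'rV[R]_11) : nat -> R :=
  let S0 := co 7 c / co 6 c ^+ 2 in
  let S1 := co 5 c in
  let S2 := co 8 c / co 6 c ^+ 4 + 5 / 4 * (S1 ^+ 2 / S0) - 4 * S0 ^+ 2 in
  let S3 := co 9 c / co 6 c ^+ 5 + 9 / 2 * (S1 * S2 / S0)
            - 15 / 4 * (S1 ^+ 3 / S0 ^+ 2) in
  let S4 := co 10 c / co 6 c ^+ 6 + 7 * (S1 * S3 / S0)
            - 63 / 4 * (S1 ^+ 2 * S2 / S0 ^+ 2) - 19 * (S0 * S2)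
            + 315 / 32 * (S1 ^+ 4 / S0 ^+ 3) + 95 / 4 * S1 ^+ 2
            - 34 * S0 ^+ 3 in
  fun k => nth 0 [:: S0; S1; S2; S3; S4] k.

(** The equations [sch k q = S k] solved in turn for [q (k + 3)]. The entry at 0 is a placeholder,
    and [q 1 = 1] since it is [u_x / u_x]. *)
Definition chart_q (q2 : R) (S : nat -> R) : nat -> R :=
  let q3 := S 0%N + 3 / 2 * q2 ^+ 2 in
  let q4 := S 1%N + 4 * (q2 * q3) - 3 * q2 ^+ 3 in
  let q5 := S 2%N + 5 * (q2 * q4) + 4 * q3 ^+ 2 - 17 * (q2 ^+ 2 * q3)
            + 9 * q2 ^+ 4 in
  let q6 := S 3%N + 6 * (q2 * q5) + 13 * (q3 * q4) - 27 * (q2 ^+ 2 * q4)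
            - 42 * (q2 * q3 ^+ 2) + 87 * (q2 ^+ 3 * q3) - 36 * q2 ^+ 5 in
  let q7 := S 4%N + 7 * (q2 * q6) + 19 * (q3 * q5) - 39 * (q2 ^+ 2 * q5)
            + 13 * q4 ^+ 2 - 164 * (q2 * (q3 * q4)) + 168 * (q2 ^+ 3 * q4)
            - 42 * q3 ^+ 3 + 387 * (q2 ^+ 2 * q3 ^+ 2) - 528 * (q2 ^+ 4 * q3)
            + 180 * q2 ^+ 6 in
  fun i => nth 0 [:: 0; 1; q2; q3; q4; q5; q6; q7] i.

Definition unchart c : 'rV[R]_11 :=
  let q := chart_q (co 4 c / co 3 c) (chart_S c) in
  rv [:: co 0 c; co 1 c; co 2 c; co 6 c * co 3 c; co 3 c; co 4 c; q 3%N * co 3 c;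
         q 4%N * co 3 c; q 5%N * co 3 c; q 6%N * co 3 c; q 7%N * co 3 c].

Lemma sch_chart_q k q2 S : (k <= 4)%N -> sch k (chart_q q2 S) = S k.
Proof. by case: k => [|[|[|[|[|//]]]]] _ /=; rewrite /chart_q /=; field. Qed.

(** Once the lower [q i] agree, [addIr] strips the common terms and leaves [q (k + 3)], whose
    coefficient is 1. *)
Lemma sch_inj (q q' : nat -> R) : q 2%N = q' 2%N ->
  (forall k, (k <= 4)%N -> sch k q = sch k q') ->
  forall i, (2 <= i <= 7)%N -> q i = q' i.
Proof.
move=> e2 E.
have e3 : q 3%N = q' 3%N by move: (E 0%N isT); rewrite /= e2 => /addIr.
have e4 : q 4%N = q' 4%N.
  by move: (E 1%N isT); rewrite /= e2 e3 => /addIr/addIr.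
have e5 : q 5%N = q' 5%N.
  by move: (E 2%N isT); rewrite /= e2 e3 e4 => /addIr/addIr/addIr/addIr.
have e6 : q 6%N = q' 6%N.
  move: (E 3%N isT); rewrite /= e2 e3 e4 e5.
  by do 6!move/addIr.
have e7 : q 7%N = q' 7%N.
  move: (E 4%N isT); rewrite /= e2 e3 e4 e5 e6.
  by do 10!move/addIr.
by do 8?[case=> [|] //].
Qed.

Lemma om_base_inj (S S' : nat -> R) : S 0%N = S' 0%N -> S 1%N = S' 1%N ->
  (forall i, (i < 4)%N -> om_base i S = om_base i S') ->
  forall k, (k <= 4)%N -> S k = S' k.
Proof.
move=> e0 e1 E.
have e2 : S 2%N = S' 2%N by move: (E 1%N isT); rewrite /= e0 e1 => /addIr/addIr.
have e3 : S 3%N = S' 3%N.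
  by move: (E 2%N isT); rewrite /= e0 e1 e2 => /addIr/addIr.
have e4 : S 4%N = S' 4%N.
  move: (E 3%N isT); rewrite /= e0 e1 e2 e3.
  by do 6!move/addIr.
by do 5?[case=> [|] //].
Qed.

Definition chart_dom c := [/\ co 3 c != 0, co 6 c != 0 & co 7 c != 0].

Lemma om_chart_S i c : chart_dom c -> (i < 4)%N ->
  om i (co 6 c) (chart_S c) = co (7 + i) c.
Proof.
move=> [c3 c6 c7]; case: i => [|[|[|[|//]]]] _;
by rewrite /om /om_weight /= /chart_S /=; field; rewrite ?c6 ?c7.
Qed.

Lemma rr_unchart c : co 3 c != 0 -> rr (unchart c) = co 6 c.
Proof. by move=> c3; rewrite /rr !co_rv //=; field. Qed.

Lemma qs_unchart c i : co 3 c != 0 -> (2 <= i <= 7)%N ->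
  qs (unchart c) i = chart_q (co 4 c / co 3 c) (chart_S c) i.
Proof.
move=> c3 i7; rewrite /qs !co_rv //; last lia.
rewrite -[RHS](mulfK c3) /=; congr (_ / _).
by case: i i7 => [|[|[|[|[|[|[|[|//]]]]]]]] //= _; rewrite /chart_q /= mulfVK.
Qed.

Lemma SS_unchart c k : co 3 c != 0 -> (k <= 4)%N -> SS (unchart c) k = chart_S c k.
Proof.
move=> c3 k4; rewrite -(sch_chart_q (co 4 c / co 3 c) (chart_S c) k4) /SS.
have E i : (2 <= i <= 7)%N ->
    qs (unchart c) i = chart_q (co 4 c / co 3 c) (chart_S c) i.
  exact: qs_unchart.
by case: k k4 => [|[|[|[|[|//]]]]] _; rewrite /sch !E.
Qed.

Lemma unchartK c : chart_dom c -> chart (unchart c) = c.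
Proof.
move=> cd; have [c3 c6 c7] := cd.
have OmE i : (i < 4)%N -> Om i (unchart c) = co (7 + i) c.
  move=> i4; rewrite -om_chart_S // /Om rr_unchart //.
  by case: i i4 => [|[|[|[|//]]]] _; rewrite /om /om_base !SS_unchart.
apply: rowP_co => k k10; rewrite co_rv // /chart_seq.
rewrite SS_unchart // rr_unchart // !OmE //.
by do 11?[case: k k10 => [|k] k10; [rewrite /= ?co_rv|]].
Qed.

Lemma unchart_jreg c : chart_dom c -> jreg (unchart c).
Proof.
move=> [c3 c6 c7]; split; first by rewrite co_rv.
  by rewrite co_rv //= mulf_neq0.
by rewrite SS_unchart // /chart_S /= mulf_neq0 // invr_neq0 // expf_neq0.
Qed.

Lemma chart_jreg y : jreg y -> chart_dom (chart y).
Proof.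
move=> [y4 y3 S0]; split; rewrite co_rv //= /rr; first by rewrite mulf_neq0 ?invr_neq0.
by rewrite /Om /om /= mulf_neq0 // expf_neq0 // mulf_neq0 ?invr_neq0.
Qed.

(** The recovered [S] has the same invariants as [SS y], and the recovered [q] the same [S] and
    [q 2] as [qs y]; the two injectivity lemmas conclude without expanding the explicit inverse. *)
Lemma chartK y : jreg y -> unchart (chart y) = y.
Proof.
move=> yr; have cd := chart_jreg yr; have [c3 c6 c7] := cd; have [y4 y3 y0] := yr.
have e3 : co 3 (chart y) = co 4 y by rewrite co_rv.
have r6 : co 6 (chart y) = rr y by rewrite co_rv.
have r0 : rr y != 0 by rewrite -r6.
have SE : forall k, (k <= 4)%N -> chart_S (chart y) k = SS y k.
  apply: om_base_inj => [||i i4].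
  - by rewrite /chart_S /= !co_rv //= /Om /om /= mulrC mulKf // expf_neq0.
  - by rewrite /chart_S /= co_rv.
  - have := om_chart_S cd i4; rewrite [RHS]co_rv; last lia.
    rewrite r6 (_ : nth _ _ _ = Om i y); last first.
      by case: i i4 => [|[|[|[|//]]]].
    by move/mulfI; apply; rewrite expf_neq0.
have qE : forall i, (2 <= i <= 7)%N ->
    chart_q (co 4 (chart y) / co 3 (chart y)) (chart_S (chart y)) i = qs y i.
  apply: sch_inj => [|k k4]; last by rewrite sch_chart_q // SE.
  by rewrite /chart_q /= !co_rv.
apply: rowP_co => k k10; rewrite co_rv // !qE // e3 r6.
by do 11?[case: k k10 => [|k] k10; [rewrite /= ?co_rv //= /qs /rr ?mulfVK|]].
Qed.

Lemma differentiable_chart_S c k : chart_dom c -> (k <= 4)%N ->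
  differentiable (fun c => chart_S c k) c.
Proof.
move=> [c3 c6 c7] k4.
have c6n n : co 6 c ^+ n != 0 by rewrite expf_neq0.
have c0 : co 7 c / co 6 c ^+ 2 != 0 by rewrite mulf_neq0 ?invr_neq0.
have c0n n : (co 7 c / co 6 c ^+ 2) ^+ n != 0 by rewrite expf_neq0.
suff [L dL] : exists L, has_diff (fun c => chart_S c k) c L by case: dL.
by case: k k4 => [|[|[|[|[|//]]]]] _; eexists; rewrite /chart_S /=; solve_has_diff => //;
  exact: has_diff_co.
Qed.

Lemma differentiable_chart_q (V : normedModType R) (q2 : V -> R)
  (S : nat -> V -> R) x i : differentiable q2 x ->
  (forall k, (k <= 4)%N -> differentiable (S k) x) -> (2 <= i <= 7)%N ->
  differentiable (fun v => chart_q (q2 v) (fun k => S k v) i) x.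
Proof.
move=> dq dS i7.
have hq : has_diff q2 x ('d q2 x) by [].
have hS k : (k <= 4)%N -> has_diff (S k) x ('d (S k) x) by move=> /dS.
have [h0 h1 h2 h3 h4] := And5 (hS 0%N isT) (hS 1%N isT) (hS 2%N isT)
  (hS 3%N isT) (hS 4%N isT).
suff [L dL] : exists L, has_diff (fun v => chart_q (q2 v) (fun k => S k v) i) x L
  by case: dL.
by case: i i7 => [|[|[|[|[|[|[|[|//]]]]]]]] //= _; eexists; rewrite /chart_q /=;
  solve_has_diff => //.
Qed.

Lemma differentiable_unchart c : chart_dom c -> differentiable unchart c.
Proof.
move=> cd; have [c3 c6 c7] := cd; apply: differentiable_rowP => -[i hi].
have dco k : differentiable (co k) c by case: (has_diff_co k c).
have dq j : (2 <= j <= 7)%N ->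
    differentiable (fun c => chart_q (co 4 c / co 3 c) (chart_S c) j) c.
  apply: (@differentiable_chart_q _ (fun c => co 4 c / co 3 c) (fun k c => chart_S c k)).
    by apply: differentiableM => //; exact: differentiableV.
  by move=> k k4; exact: differentiable_chart_S.
have E k : (k < 11)%N -> (fun c => unchart c 0 (inord k)) = 
  fun c => nth 0 (let q := chart_q (co 4 c / co 3 c) (chart_S c) in
   [:: co 0 c; co 1 c; co 2 c; co 6 c * co 3 c; co 3 c; co 4 c; q 3%N * co 3 c;
         q 4%N * co 3 c; q 5%N * co 3 c; q 6%N * co 3 c; q 7%N * co 3 c]) k.
  by move=> k11; apply/funext => y; rewrite mxE inordK.
rewrite -[Ordinal hi]inord_val E //=.
do 11?[case: i hi => [|i] hi; [by first [exact: dco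
  | apply: differentiableM => //; exact: dq]|]].
by [].
Qed.

End Chart.

(** * Solutions of the seven conditions *)

Section Fields.
Variable R : realType.

Lemma Zgen_field_x n : (n <= 2)%N -> exists j, Zgen j = @field_x R n.
Proof.
by case: n => [|[|[|//]]] _; [exists (@Ordinal 7 0 isT)
  | exists (@Ordinal 7 1 isT) | exists (@Ordinal 7 2 isT)].
Qed.

Lemma Zgen_field_u n : (n <= 2)%N -> exists j, Zgen j = @field_u R n.
Proof.
by case: n => [|[|[|//]]] _; [exists (@Ordinal 7 3 isT)
  | exists (@Ordinal 7 4 isT) | exists (@Ordinal 7 5 isT)].
Qed.

Lemma Zgen_field_t : exists j, Zgen j = @field_t R.
Proof. by exists (@Ordinal 7 6 isT). Qed.

End Fields.

Section Constancy.
Context {R : realType}.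
Implicit Types y c : 'rV[R]_11.

(** A jet above [y]; the derivatives of [u] outside [jcoord] are set to 0. *)
Definition row_jet y : jet R :=
  Jet (co 0 y) (co 1 y) (fun p q =>
    if q is 0 then co (xidx p) y else if (p == 0) && (q == 1) then co 3 y else 0).

Lemma row_jetK y : jcoord (row_jet y) = y.
Proof.
apply: rowP_co => k k10; rewrite co_jcoord //.
by do 11?[case: k k10 => [|k] k10; [|]].
Qed.

Definition annihilated (w : 'rV[R]_11 -> R) y := forall j z, jcoord z = y ->
  prolong 7 (Zgen j) (fun z => w (jcoord z)) z = 0.

Lemma row_sum n (f : {linear 'rV[R]_n.+1 -> R}) (v : 'rV[R]_n.+1) :
  f v = \sum_(k < n.+1) co k v * f (delta_mx 0 k).
Proof.
rewrite {1}[v]row_sum_delta linear_sum; apply: eq_bigr => k _.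
by rewrite linearZ /co inord_val.
Qed.

Lemma near_jreg y : jreg y -> \forall y' \near y, jreg y'.
Proof.
move=> [y4 y3 S0]; have nS := has_diff_neq0 (has_diff_Sy 0 y4) S0.
by near=> y'; split; near: y' => //; exact: near_co_neq0.
Unshelve. all: by end_near. Qed.

(* The seven conditions read [d (w o unchart) (Z_j (chart)) = 0], a triangular
   system for the first seven partial derivatives of [w o unchart]. *)
Lemma annihilated_diff (w : 'rV[R]_11 -> R) c (v : 'rV[R]_11) : chart_dom c ->
  differentiable w (unchart c) -> annihilated w (unchart c) ->
  (forall k, (7 <= k <= 10)%N -> co k v = 0) ->
  'd (w \o unchart) c v = 0.
Proof.
move=> cd dw w0 v0; set y := unchart c.
have yr : jreg y by exact: unchart_jreg.
have [y4 y3 S0] := yr.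
have cE : chart y = c by exact: unchartK.
have dg : differentiable (w \o unchart) c.
  by apply: differentiable_comp => //; exact: differentiable_unchart.
set G := 'd (w \o unchart) c.
have jreg_near := near_jreg yr.
(* Near [y], [w] is [(w \o unchart) \o chart], so the chain rule writes its differential through
   [G]. *)
have dwy : has_diff w y (fun u => G (rv (dchart_seq y u))).
  apply: (@has_diff_near _ _ (fun y => (w \o unchart) (chart y))).
    by near=> y'; rewrite /= chartK //; near: y'.
  have hG : has_diff (w \o unchart) (chart y) G by rewrite cE; split; first exact: dg.
  apply: has_diff_eq (has_diff_comp (differentiable_chart yr) hG) _ => u.
  by rewrite diff_chart.
have [z [zy z1]] : exists z, jcoord z = y /\ ju z 1 0 != 0.
  by exists (row_jet y); split; [exact: row_jetK | exact: y4].
have rep : represents w (fun z => w (jcoord z)) z.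
  exact: represents_everywhere.
have dwz : has_diff w (jcoord z) (fun u => G (rv (dchart_seq y u))) by rewrite zy.
have GX n : (n <= 2)%N -> G (rv (dchart_seq y (zeta_x n z))) = 0.
  move=> n2; rewrite -(prolong_field_x n2 dwz rep).
  by have [j <-] := Zgen_field_x R n2; exact: w0 zy.
have GU n : (n <= 2)%N -> G (rv (dchart_seq y (zeta_u n z))) = 0.
  move=> n2; rewrite -(prolong_field_u n2 dwz rep).
  by have [j <-] := Zgen_field_u R n2; exact: w0 zy.
have GT : G (rv (dchart_seq y zeta_t)) = 0.
  rewrite -(prolong_field_t dwz rep).
  by have [j <-] := Zgen_field_t R; exact: w0 zy.
pose g k := G (delta_mx 0 (inord k)).
have GE u : G u = co 0 u * g 0%N + co 1 u * g 1%N + co 2 u * g 2%N +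
    co 3 u * g 3%N + co 4 u * g 4%N + co 5 u * g 5%N + co 6 u * g 6%N +
    (co 7 u * g 7%N + co 8 u * g 8%N + co 9 u * g 9%N + co 10 u * g 10%N).
  rewrite row_sum !big_ord_recl big_ord0 addr0 !addrA.
  by do 10?[congr (_ + _)]; congr (_ * G (delta_mx _ _)); apply/val_inj;
     rewrite /= inordK.
have {}zE : y = jcoord z by rewrite zy.
have S0z : SS (jcoord z) 0 != 0 by rewrite zy.
have {}GX n : (n <= 2)%N -> jx z ^+ n * g 0%N
    - n%:R * jx z ^+ n.-1 * ju z 1 0 * g 3%N
    + coef_x n (jx z) (fun i => ju z i 0) 2 * g 4%N
    - (n%:R * jx z ^+ n.-1 * 3 * SS y 1 + (n == 2)%:R * 4 * SS y 0) * g 5%N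
    + n%:R * jx z ^+ n.-1 * rr y * g 6%N = 0.
  move=> n2; have := GX n n2; rewrite GE !co_rv //= zE !dOm_zeta_x //.
  rewrite dSS_zeta_x // drr_zeta_x // !co_rv //= /coef_x => <-.
  have -> : 'C(n, 2) = (n == 2%N) by case: n n2 => [|[|[|]]].
  by case: n n2 => [|[|[|//]]] _ /=; ring.
have {}GU n : (n <= 2)%N -> ju z 0 0 ^+ n * g 2%N
    + coef_u n (fun i => ju z i 0) 1 * g 3%N
    + coef_u n (fun i => ju z i 0) 2 * g 4%N = 0.
  move=> n2; have := GU n n2; rewrite GE !co_rv //= zE !dOm_zeta_u //.
  rewrite dSS_zeta_u // drr_zeta_u // !co_rv //= => <-.
  by ring.
have g1 : g 1%N = 0.
  have := GT; rewrite GE !co_rv //= zE !dOm_zeta_t // dSS_zeta_t // drr_zeta_t //.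
  by rewrite !co_rv //= => <-; ring.
have g2 : g 2%N = 0 by have := GU 0%N isT; rewrite /= mul1r !mul0r !addr0.
have g0 : g 0%N = 0.
  by have := GX 0%N isT; rewrite /coef_x bin0n /= => <-; ring.
have g4 : g 4%N = 0.
  have := GU 2%N isT; have := GU 1%N isT; rewrite /= g2 => E1 E2.
  (* The combination [Z_6 - 2 u Z_5] eliminates [g 3]. *)
  have E : 2 * ju z 1 0 ^+ 2 * g 4%N = 0.
    have := congr2 (fun a b => b - 2 * ju z 0 0 * a) E1 E2.
    rewrite /= [X in _ = X](_ : _ = 0); last by ring.
    by move=> E; rewrite -[RHS]E; ring.
  apply: (@mulfI _ (2 * ju z 1 0 ^+ 2)); last by rewrite mulr0.
  by rewrite mulf_neq0 ?expf_neq0 ?pnatr_eq0.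
have g3 : g 3%N = 0.
  have := GU 1%N isT; rewrite /= g2 g4 !mulr0 addr0 add0r => /eqP.
  by rewrite mulf_eq0 (negPf z1) => /eqP.
have g5 : g 5%N = 0.
  have := GX 2%N isT; have := GX 1%N isT; rewrite g0 g3 g4 /= => E1 E2.
  (* The combination [2 x Z_2 - Z_3] eliminates [g 6]; the factor [4 S] is the amount by which [Z_3]
     moves [S_x]. *)
  have E : 4 * SS y 0 * g 5%N = 0.
    have := congr2 (fun a b => 2 * jx z * a - b) E1 E2.
    rewrite /= [X in _ = X](_ : _ = 0); last by ring.
    by move=> E; rewrite -[RHS]E; ring.
  apply: (@mulfI _ (4 * SS y 0)); last by rewrite mulr0.
  by rewrite mulf_neq0 ?pnatr_eq0.
have g6 : g 6%N = 0.
  have := GX 1%N isT; rewrite g0 g3 g4 g5 /= => E.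
  have {E} : rr y * g 6%N = 0 by rewrite -E; ring.
  rewrite -[RHS](mulr0 (rr y)); apply: mulfI.
  by rewrite mulf_neq0 ?invr_neq0.
by rewrite GE g0 g1 g2 g3 g4 g5 g6 (v0 7%N) // (v0 8%N) // (v0 9%N) // (v0 10%N) //; ring.
Unshelve. all: by end_near. Qed.

End Constancy.

(** * Constancy along fibres and restriction to a slice *)

Section Factor.
Context {R : realType}.
Implicit Types (c b y : 'rV[R]_11) (o : 'rV[R]_4) (w : 'rV[R]_11 -> R).

Lemma coD n k (y z : 'rV[R]_n.+1) : co k (y + z) = co k y + co k z.
Proof. by rewrite /co mxE. Qed.

Lemma coN n k (y : 'rV[R]_n.+1) : co k (- y) = - co k y.
Proof. by rewrite /co mxE. Qed.

Lemma coZ n k a (y : 'rV[R]_n.+1) : co k (a *: y) = a * co k y.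
Proof. by rewrite /co mxE. Qed.

Definition segment c c' (s : R) := c + s *: (c' - c).

Lemma co_segment k c c' s :
  co k (segment c c' s) = co k c + s * (co k c' - co k c).
Proof. by rewrite coD coZ coD coN. Qed.

(** The direction [c' - c] has no component along the invariants, so [annihilated_diff] makes the
    derivative along the segment vanish, and the mean value theorem applies. *)
Lemma constant_along_fibres w c c' :
  (forall s, 0 <= s <= 1 -> let b := segment c c' s in
     [/\ chart_dom b, differentiable w (unchart b) & annihilated w (unchart b)]) ->
  (forall k, (7 <= k <= 10)%N -> co k c = co k c') ->
  w (unchart c) = w (unchart c').
Proof.
move=> H cc'; pose h s := w (unchart (segment c c' s)).
have dh (s : R) : s \in `[0, 1]%R -> is_derive s 1 h 0.
  rewrite in_itv /= => /H [bd dw w0].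
  have dseg : is_diff s (segment c c') (fun t : R => t *: (c' - c)).
    have := is_diffD (is_diff_cst c s) (is_diff_scalel s (c' - c)).
    by rewrite add0r.
  have dg : differentiable (w \o unchart) (segment c c' s).
    exact: (differentiable_comp (differentiable_unchart bd) dw).
  have dg' : has_diff (w \o unchart) (segment c c' s)
    ('d (w \o unchart) (segment c c' s)) by split.
  apply/has_diff1; apply: has_diff_eq (has_diff_comp _ dg') _.
    exact: ex_diff.
  move=> t; rewrite diff_val linearZ /= (annihilated_diff bd dw w0).
    by rewrite scaler0 mulr0.
  by move=> k k7; rewrite coD coN cc' // subrr.
have h_oo (s : R) : s \in `]0, 1[%R -> is_derive s 1 h ((fun=> 0) s).
  by move=> s01; apply: dh; exact: subset_itv_oo_cc s01.
have h_cont : {within `[0, 1], continuous h}.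
  by apply: derivable_within_continuous => s /dh [].
have h10 : h 1 - h 0 = 0.
  have [s _ E] := MVT_segment ler01 h_oo h_cont.
  by rewrite E mul0r.
have seg0 : segment c c' 0 = c by rewrite /segment scale0r addr0.
have seg1 : segment c c' 1 = c' by rewrite /segment scale1r addrC subrK.
apply/esym/eqP; rewrite -subr_eq0 -{1}seg1 -{2}seg0; exact/eqP.
Qed.

Definition join c o : 'rV[R]_11 :=
  rv [:: co 0 c; co 1 c; co 2 c; co 3 c; co 4 c; co 5 c; co 6 c;
         co 0 o; co 1 o; co 2 o; co 3 o].

Lemma differentiable_join c o : differentiable (join c) o.
Proof.
apply: differentiable_rowP => i.
have -> : (fun o => join c o 0 i) = fun o => nth 0
    [:: co 0 c; co 1 c; co 2 c; co 3 c; co 4 c; co 5 c; co 6 c;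
     co 0 o; co 1 o; co 2 o; co 3 o] i by apply/funext => o'; rewrite mxE.
case: i => i hi /=.
by do 11?[case: i hi => [|i] hi; [first [exact: differentiable_cst
   | by case: (has_diff_co 0 o) | by case: (has_diff_co 1 o)
   | by case: (has_diff_co 2 o) | by case: (has_diff_co 3 o)]|]].
Qed.

Lemma co_omega k (z : jet R) : ju z 1 0 != 0 -> (k < 4)%N ->
  co k (omega z) = Om k (jcoord z).
Proof. by move=> z1 k4; rewrite /co omegaE // inordK. Qed.

Lemma join_chart (z : jet R) : ju z 1 0 != 0 ->
  join (chart (jcoord z)) (omega z) = chart (jcoord z).
Proof.
move=> z1; apply: rowP_co => k k10; rewrite [LHS]co_rv // !co_omega //.
by do 11?[case: k k10 => [|k] k10; [rewrite /= ?co_rv|]].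
Qed.

Lemma differentiable_section w c o : chart_dom (join c o) ->
  differentiable w (unchart (join c o)) ->
  differentiable (fun o => w (unchart (join c o))) o.
Proof.
move=> cd dw; apply: (@differentiable_comp _ _ _ _ (fun o => unchart (join c o)) w) => //.
apply: (@differentiable_comp _ _ _ _ (join c) unchart).
  exact: differentiable_join.
exact: differentiable_unchart.
Qed.

(** [B] is a convex region of the chart containing both the point and its projection to the slice
    through [c0]. It is a product of lines and half-lines in the global statement and a ball in the
    local one. *)
Lemma factor_through_omega w (B : set 'rV[R]_11) c0 (z : jet R) :
  (forall b, B b ->
     [/\ chart_dom b, differentiable w (unchart b) & annihilated w (unchart b)]) ->
  (forall c c' s, B c -> B c' -> 0 <= s <= 1 -> B (segment c c' s)) ->
  jreg (jcoord z) -> B (chart (jcoord z)) -> B (join c0 (omega z)) ->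
  differentiable (fun o => w (unchart (join c0 o))) (omega z) /\
  w (jcoord z) = w (unchart (join c0 (omega z))).
Proof.
move=> HB convB yr Bz Bj; have z1 : ju z 1 0 != 0.
  by case: yr => + _ _; rewrite co4_jcoord.
split; first by have [cd dw _] := HB _ Bj; exact: differentiable_section.
rewrite -{1}(chartK yr); apply: constant_along_fibres => [s s01 b|].
  by apply: HB; exact: convB.
move=> k k7; rewrite -{1}(join_chart z1) !co_rv //; try lia.
by do 11?[case: k k7 => [|k] k7; [by []|]].
Qed.

Definition same_side c0 c :=
  [/\ 0 < co 3 c0 * co 3 c, 0 < co 6 c0 * co 6 c & 0 < co 7 c0 * co 7 c].

Lemma same_side_segment c0 c c' s : same_side c0 c -> same_side c0 c' ->
  0 <= s <= 1 -> same_side c0 (segment c c' s).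
Proof.
have aux (a b b' : R) : 0 < a * b -> 0 < a * b' -> 0 <= s <= 1 ->
    0 < a * (b + s * (b' - b)).
  move=> h h' /andP[s0 s1].
  have -> : a * (b + s * (b' - b)) = (1 - s) * (a * b) + s * (a * b') by ring.
  have [->|s_neq] := eqVneq s 0; first by rewrite subr0 mul1r mul0r addr0.
  apply: ltr_wpDl; first by rewrite mulr_ge0 ?subr_ge0 // ltW.
  by rewrite mulr_gt0 // lt_neqAle eq_sym s_neq.
by move=> [h3 h6 h7] [k3 k6 k7] s01; split; rewrite co_segment; exact: aux.
Qed.

Lemma same_side_dom c0 c : same_side c0 c -> chart_dom c.
Proof.
by move=> [h3 h6 h7]; split; [move: h3|move: h6|move: h7];
  apply: contraTneq => ->; rewrite mulr0 ltxx.
Qed.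

Lemma jreg_regular (z : jet R) : regular z <-> jreg (jcoord z).
Proof.
split=> [[/omega_domP [z1 S0] ut]|[z1 ut S0]].
  by split; rewrite ?co_jcoord.
by split; [apply/omega_domP|]; move: z1 ut; rewrite !co_jcoord.
Qed.

(** Given the sign of [u_x], fixing the sign of [u_t] is fixing that of [r]; and [omega_1 = r^2 S]
    has the sign of [S]. *)
Lemma component_chart (z0 z : jet R) : regular z0 -> component z0 z <->
  jreg (jcoord z) /\ same_side (chart (jcoord z0)) (chart (jcoord z)).
Proof.
move=> /jreg_regular [p0 v0 S0].
have SE (t : jet R) : ju t 1 0 != 0 -> schwarzian t = SS (jcoord t) 0
  := @schwE _ 0 t isT.
have neq0 (a b : R) : 0 < a * b -> b != 0.
  by apply: contraTneq => ->; rewrite mulr0 ltxx.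
have rM : jreg (jcoord z) -> rr (jcoord z0) * rr (jcoord z) =
    ju z0 0 1 * ju z 0 1 / (ju z0 1 0 * ju z 1 0).
  move=> [p v _]; move: p0 p; rewrite /rr !co_jcoord //= => p0 p.
  by field; rewrite p p0.
have oM : Om 0 (jcoord z0) * Om 0 (jcoord z) =
    (rr (jcoord z0) * rr (jcoord z)) ^+ 2 * (SS (jcoord z0) 0 * SS (jcoord z) 0).
  by rewrite /Om /om /=; ring.
have z01 : ju z0 1 0 != 0 by rewrite -co4_jcoord.
rewrite /component /same_side !co_rv //= oM !co4_jcoord.
split=> [[hp hv]|[yr [hp hr ho]]].
  have z1 := neq0 _ _ hp; rewrite !SE // => hS.
  have yr : jreg (jcoord z).
    split; first by rewrite co4_jcoord.
      by rewrite co_jcoord //= (neq0 _ _ hv).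
    exact: neq0 hS.
  have r_gt0 : 0 < rr (jcoord z0) * rr (jcoord z) by rewrite rM // divr_gt0.
  by split=> //; split=> //; rewrite mulr_gt0 // exprn_gt0.
have z1 := neq0 _ _ hp; split=> //.
  by move: hr; rewrite rM // pmulr_lgt0 // invr_gt0.
by move: ho; rewrite !SE // pmulr_rgt0 // exprn_gt0.
Qed.

Lemma component_row_jet (z0 : jet R) b : regular z0 ->
  same_side (chart (jcoord z0)) b -> component z0 (row_jet (unchart b)).
Proof.
move=> z0r sb; have bd := same_side_dom sb.
apply/component_chart => //; rewrite row_jetK unchartK //.
by split=> //; exact: unchart_jreg.
Qed.

Lemma same_side_join c0 c o : same_side c0 c -> co 0 o = co 7 c ->
  same_side c0 (join c0 o).
Proof.
move=> sc oc; have [h3 h6 h7] := sc.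
have sq (a b : R) : 0 < a * b -> 0 < a * a.
  move=> ab; rewrite -expr2 exprn_even_gt0 //=.
  by move: ab; apply: contraTneq => ->; rewrite mul0r ltxx.
by split; rewrite co_rv //= ?oc //; [exact: sq h3 | exact: sq h6].
Qed.

Lemma same_side_omega (z0 z : jet R) : regular z0 -> component z0 z ->
  same_side (chart (jcoord z0)) (join (chart (jcoord z0)) (omega z)).
Proof.
move=> z0r /(component_chart z z0r) [[p _ _] sz].
apply: same_side_join sz _.
by rewrite co_omega -?co4_jcoord // co_rv.
Qed.

Lemma component_factor (w : 'rV[R]_11 -> R) (z0 : jet R) :
  regular z0 ->
  (forall z : jet R, component z0 z -> differentiable w (jcoord z)) ->
  (forall (j : 'I_7) (z : jet R), component z0 z ->
     prolong 7 (Zgen j) (fun t => w (jcoord t)) z = 0) ->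
  exists Psi : 'rV[R]_4 -> R,
    forall z : jet R, component z0 z ->
      differentiable Psi (omega z) /\ w (jcoord z) = Psi (omega z).
Proof.
move=> z0r dw w0; pose c0 := chart (jcoord z0).
exists (fun o => w (unchart (join c0 o))) => z zC.
have /(component_chart z z0r) [yr sz] := zC.
apply: (@factor_through_omega _ (same_side c0)) => //.
- move=> b sb; have bC := component_row_jet z0r sb.
  split; first exact: same_side_dom sb.
    by rewrite -[unchart b]row_jetK; exact: dw.
  move=> j z' z'b; apply: w0; apply/component_chart => //.
  have bd := same_side_dom sb.
  by rewrite z'b unchartK //; split=> //; exact: unchart_jreg.
- by move=> c c' s; exact: same_side_segment.
- exact: same_side_omega.
Qed.

Lemma nbhs_same_side c : chart_dom c -> \forall b \near c, same_side c b.
Proof.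
have near_pos k : co k c != 0 -> \forall b \near c, 0 < co k c * co k b.
  move=> ck.
  have cv : (fun b => co k c * co k b) @ c --> co k c * co k c.
    have [dk _] := has_diffM (has_diff_cst (co k c) c) (has_diff_co k c).
    exact: (differentiable_continuous dk).
  apply: (cv [set t | 0 < t]).
  apply: open_nbhs_nbhs; split; first exact: open_gt.
  by rewrite /= -expr2 exprn_even_gt0.
by move=> [c3 c6 c7]; near=> b; split; near: b; exact: near_pos.
Unshelve. all: by end_near. Qed.

(** A ball for the sup norm is convex and contains, with a point, the point obtained by resetting
    its first seven coordinates to those of the centre. Hence the slice is taken through the centre
    [c0]. *)
Lemma local_factor (w : 'rV[R]_11 -> R) (U : set 'rV[R]_11) (z0 : jet R) :
  regular z0 -> open U -> U (jcoord z0) ->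
  (forall y, U y -> differentiable w y) ->
  (forall (j : 'I_7) (z : jet R), U (jcoord z) ->
     prolong 7 (Zgen j) (fun t => w (jcoord t)) z = 0) ->
  exists (V : set 'rV[R]_11) (Psi : 'rV[R]_4 -> R),
    [/\ open V, V (jcoord z0) &
        forall z : jet R, V (jcoord z) ->
          differentiable Psi (omega z) /\ w (jcoord z) = Psi (omega z)].
Proof.
move=> /jreg_regular y0r oU U0 dw w0; pose c0 := chart (jcoord z0).
have c0d : chart_dom c0 by exact: chart_jreg.
have near_c0 : \forall b \near c0, same_side c0 b /\ U (unchart b).
  near=> b; split; near: b; first exact: nbhs_same_side.
  have cu := differentiable_continuous (differentiable_unchart c0d).
  apply: (cu U); rewrite /c0 chartK //.
  exact: open_nbhs_nbhs.
have [e /= e0 Be] : exists2 e : R, 0 < e & ball c0 e `<=`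
    [set b | same_side c0 b /\ U (unchart b)] by apply/nbhs_ballP.
have near_y0 : \forall y \near jcoord z0, jreg y /\ ball c0 e (chart y).
  near=> y; split; near: y; first exact: near_jreg.
  have cc := differentiable_continuous (differentiable_chart y0r).
  by apply: (cc (ball c0 e)); exact: nbhsx_ballx.
pose V := interior [set y | jreg y /\ ball c0 e (chart y)].
exists V, (fun o => w (unchart (join c0 o))); split.
- exact: open_interior.
- exact: near_y0.
move=> z /interior_subset [yr zb].
have ballP b : ball c0 e b <-> forall k, (k <= 10)%N -> `|co k c0 - co k b| < e.
  split=> [[_ bb] k k10|bb]; first exact: bb 0 (inord k).
  by split=> // i j; have := bb j (ltn_ord j); rewrite /co inord_val ord1.
apply: (@factor_through_omega _ (ball c0 e)) => //.
- move=> b /Be [sb Ub]; split; first exact: same_side_dom sb.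
    exact: dw.
  by move=> j z' z'b; apply: w0; rewrite z'b.
- move=> c c' s /ballP Bc /ballP Bc' /andP[s0 s1]; apply/ballP => k k10.
  rewrite co_segment.
  have -> : co k c0 - (co k c + s * (co k c' - co k c)) =
    (1 - s) * (co k c0 - co k c) + s * (co k c0 - co k c') by ring.
  apply: (le_lt_trans (ler_normD _ _)); rewrite !normrM.
  rewrite (ger0_norm s0) (@ger0_norm _ (1 - s)) ?subr_ge0 //.
  move: (Bc k k10) (Bc' k k10).
  set a := `|co k c0 - co k c|; set b := `|co k c0 - co k c'| => ae be.
  apply: (@le_lt_trans _ _ (Num.max a b)); last by rewrite gt_max ae be.
  have am : a <= Num.max a b by rewrite le_max lexx.
  have bm : b <= Num.max a b by rewrite le_max lexx orbT.
  by nra.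
- have z1 : ju z 1 0 != 0 by rewrite -co4_jcoord; case: yr.
  apply/ballP => k k10; have /ballP/(_ k k10) := zb.
  rewrite -(join_chart z1) /join !co_rv //.
  by do 11?[case: k k10 => [|k] k10; [rewrite /= ?subrr ?normr0|]].
Unshelve. all: by end_near. Qed.

End Factor.

(** * Calculus in one variable *)

Section Smooth1D.
Context {R : realType}.
Implicit Types (f g : R -> R) (x y : R) (n k : nat).

Definition deriv_near x f f' :=
  \forall y \near x, has_diff f y (fun h => h * f' y).

(** Identities that hold near a point can be differentiated: a neighbourhood of [x] is one of every
    point close to [x]. The transformation laws of higher derivatives are obtained this way. *)
Lemma deriv_near_unique x f f' g g' : deriv_near x f f' -> deriv_near x g g' ->
  (\forall y \near x, f y = g y) -> \forall y \near x, f' y = g' y.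
Proof.
move=> df dg /near_join fg; near=> y.
have dfy : has_diff f y (fun h => h * f' y) by near: y.
have dgy : has_diff g y (fun h => h * g' y) by near: y.
have fgy : \forall y' \near y, f y' = g y' by near: y.
have := has_diff_unique (has_diff_near fgy dfy) dgy 1.
by rewrite !mul1r.
Unshelve. all: by end_near. Qed.

Lemma deriv_near_eq x f f' g : (\forall y \near x, f y = g y) ->
  deriv_near x f f' -> deriv_near x g f'.
Proof.
move=> /near_join fg df; near=> y; apply: (@has_diff_near _ _ f).
  by near: y.
by near: y.
Unshelve. all: by end_near. Qed.

Fixpoint cn n f x : Prop :=
  if n is n'.+1 then exists2 f', deriv_near x f f' & cn n' f' x else True.

Lemma cn_lower n f x : cn n.+1 f x -> cn n f x.
Proof.
elim: n f => [//|n IH] f [f' df cf]; exists f' => //; exact: IH.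
Qed.

Lemma cn_cst n (c : R) x : cn n (fun=> c) x.
Proof.
elim: n c => [//|n IH] c; exists (fun=> 0) => //.
near=> y; apply: has_diff_eq (has_diff_cst _ _) _ => h.
by rewrite mulr0.
Unshelve. all: by end_near. Qed.

Lemma has_diff_id x : has_diff (fun y : R => y) x (fun h => h).
Proof.
have : has_diff (fun y : R => y) x (fun h => h * 1).
  by apply/has_diff1; exact: is_derive_id.
by move=> D; apply: has_diff_eq D _ => h; rewrite mulr1.
Qed.

Lemma cn_id n x : cn n (fun y : R => y) x.
Proof.
case: n => [//|n]; exists (fun=> 1); last exact: cn_cst.
near=> y; apply: has_diff_eq (has_diff_id y) _ => h.
by rewrite mulr1.
Unshelve. all: by end_near. Qed.

Lemma cnD n f g x : cn n f x -> cn n g x -> cn n (fun y => f y + g y) x.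
Proof.
elim: n f g => [//|n IH] f g [f' df cf] [g' dg cg].
exists (fun y => f' y + g' y); last exact: IH.
near=> y; have dfy : has_diff f y (fun h => h * f' y) by near: y.
have dgy : has_diff g y (fun h => h * g' y) by near: y.
by apply: has_diff_eq (has_diffD dfy dgy) _ => h; rewrite mulrDr.
Unshelve. all: by end_near. Qed.

Lemma cnM n f g x : cn n f x -> cn n g x -> cn n (fun y => f y * g y) x.
Proof.
elim: n f g => [//|n IH] f g cfn cgn; have cf0 := cn_lower cfn.
have cg0 := cn_lower cgn; move: cfn cgn => [f' df cf] [g' dg cg].
exists (fun y => f' y * g y + f y * g' y); last by apply: cnD; exact: IH.
near=> y; have dfy : has_diff f y (fun h => h * f' y) by near: y.
have dgy : has_diff g y (fun h => h * g' y) by near: y.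
by apply: has_diff_eq (has_diffM dfy dgy) _ => h /=; ring.
Unshelve. all: by end_near. Qed.

Lemma has_diff_compR (h f : R -> R) (x f' h' : R) : has_diff f x (fun t => t * f') ->
  has_diff h (f x) (fun t => t * h') ->
  has_diff (fun y => h (f y)) x (fun t => t * (f' * h')).
Proof.
move=> [df dL] dh; apply: has_diff_eq (has_diff_comp df dh) _ => t /=.
by rewrite dL mulrA.
Qed.

Lemma deriv_near_comp x f f' (h h' : R -> R) : deriv_near x f f' ->
  deriv_near (f x) h h' ->
  deriv_near x (fun y => h (f y)) (fun y => f' y * h' (f y)).
Proof.
move=> df dh; have [/differentiable_continuous cf _] := nbhs_singleton df.
have {}dh := cf _ dh; near=> y; by apply: has_diff_compR; near: y.
Unshelve. all: by end_near. Qed.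

Lemma cn_comp n f (h : R -> R) x : cn n f x -> cn n h (f x) ->
  cn n (fun y => h (f y)) x.
Proof.
elim: n h => [//|n IH] h cfn; have cf0 := cn_lower cfn.
move: cfn => [f' df cf] [h' dh ch].
exists (fun y => f' y * h' (f y)); first exact: deriv_near_comp.
by apply: cnM => //; exact: IH.
Qed.

Lemma near_lin_neq0 (a b x : R) : a * x + b != 0 ->
  \forall y \near x, a * y + b != 0.
Proof.
move=> ab.
have D := has_diffD (has_diffM (has_diff_cst a x) (has_diff_id x))
  (has_diff_cst b x).
exact: has_diff_neq0 D ab.
Qed.

Lemma cn_inv_lin n (a b x : R) : a * x + b != 0 ->
  cn n (fun y => (a * y + b)^-1) x.
Proof.
move=> ab; elim: n => [//|n IH].
exists (fun y => - a * ((a * y + b)^-1 * (a * y + b)^-1)); last first.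
  by apply: cnM; [exact: cn_cst|exact: cnM].
have := near_lin_neq0 ab; apply: filterS => y yb.
have D := has_diffD (has_diffM (has_diff_cst a y) (has_diff_id y))
  (has_diff_cst b y).
have E := has_diffV (f := fun t => a * t + b) yb D.
by apply: has_diff_eq E _ => h /=; field.
Qed.

Lemma cn_mobius n (a b c d x : R) : c * x + d != 0 -> cn n (mobius a b c d) x.
Proof.
move=> cd; apply: cnM; last exact: cn_inv_lin.
by apply: cnD; [apply: cnM; [exact: cn_cst|exact: cn_id]|exact: cn_cst].
Qed.

Lemma derive1n_near k f g x : (\forall y \near x, f y = g y) ->
  \forall y \near x, derive1n k f y = derive1n k g y.
Proof.
elim: k f g => [//|k IH] f g /near_join fg.
rewrite !derive1Sn; apply: IH; move: fg; apply: filterS => y fg.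
by rewrite !derive1E; exact: near_eq_derive.
Qed.

(** The derivatives witnessing [cn] agree with [derive1] near [x] only, but agreement near [x]
    passes to all iterated derivatives. *)
Lemma cn_derive1n n f x k : cn n f x -> (k < n)%N ->
  deriv_near x (derive1n k f) (derive1n k.+1 f).
Proof.
elim: n f k => [//|n IH] f k [f' df cf].
have f'E : \forall y \near x, f' y = (derive1 f) y.
  move: df; apply: filterS => y dfy.
  by have [_ <-] := (has_diff1 _ _ _).2 dfy; rewrite derive1E.
case: k => [_|k kn].
  move: df; rewrite /deriv_near => df; near=> y.
  have D : has_diff f y (fun h => h * f' y) by near: y.
  apply: has_diff_eq D _ => h; rewrite derive1n1; congr (_ * _).
  by near: y.
have := IH _ _ cf kn; rewrite !derive1Sn => D.
have E i := derive1n_near i f'E.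
have := deriv_near_eq (E k) D; rewrite -!derive1Sn => {}D.
have Ek := E k.+1; near=> y.
have Dy : has_diff (derive1n k.+1 f) y (fun h => h * (derive1n k.+1 f') y) by near: y.
apply: has_diff_eq Dy _ => h; rewrite [in RHS]derive1Sn; congr (_ * _).
by near: y.
Unshelve. all: by end_near. Qed.

End Smooth1D.

(** * Functions of two variables restricted to coordinate lines *)

Section Slices.
Context {R : realType}.
Implicit Types (u : R * R -> R) (s t : R) (P : R * R).

Let quotient_x u s t :
  (fun h : R => h^-1 *: ((u \o shift (s, t)) (h *: (1, 0)) - u (s, t))) =
  (fun h => h^-1 *: (((fun s' => u (s', t)) \o shift s) (h *: 1) - u (s, t))).
Proof.
apply/funext => h /=; congr (_ *: (u _ - _)).
by congr (_, _); rewrite /= [h *: 0]mulr0 add0r.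
Qed.

Let quotient_t u s t :
  (fun h : R => h^-1 *: ((u \o shift (s, t)) (h *: (0, 1)) - u (s, t))) =
  (fun h => h^-1 *: (((fun t' => u (s, t')) \o shift t) (h *: 1) - u (s, t))).
Proof.
apply/funext => h /=; congr (_ *: (u _ - _)).
by congr (_, _); rewrite /= [h *: 0]mulr0 add0r.
Qed.

Lemma dpxE u s t : dpx u (s, t) = derive1 (fun s' => u (s', t)) s.
Proof. by rewrite derive1E /dpx /derive quotient_x. Qed.

Lemma dptE u s t : dpt u (s, t) = derive1 (fun t' => u (s, t')) t.
Proof. by rewrite derive1E /dpt /derive quotient_t. Qed.

Lemma iter_dpxE k u s t :
  iter k dpx u (s, t) = derive1n k (fun s' => u (s', t)) s.
Proof.
elim: k s t => [//|k IH] s t; rewrite iterS dpxE derive1nS.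
by congr (derive1 _ s); apply/funext => s'; rewrite IH.
Qed.

Lemma has_diff_slice_x u s t : differentiable u (s, t) ->
  has_diff (fun s' => u (s', t)) s (fun h => h * dpx u (s, t)).
Proof.
move=> du; apply/has_diff1; rewrite dpxE derive1E.
have := @diff_derivable _ _ _ u (s, t) (1, 0) du.
by rewrite /derivable quotient_x => /derivableP.
Qed.

Lemma has_diff_slice_t u s t : differentiable u (s, t) ->
  has_diff (fun t' => u (s, t')) t (fun h => h * dpt u (s, t)).
Proof.
move=> du; apply/has_diff1; rewrite dptE derive1E.
have := @diff_derivable _ _ _ u (s, t) (0, 1) du.
by rewrite /derivable quotient_t => /derivableP.
Qed.

Lemma smooth_near_slice n u s t : smooth_near u (s, t) ->
  cn n (fun s' => u (s', t)) s.
Proof.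
move=> [U [oU UP cU]]; have {cU} := cU n.
have nearU : \forall s' \near s, U (s', t).
  have [[A B] /= [nA nB] AB] : nbhs (s, t) U by exact: open_nbhs_nbhs.
  apply: filterS nA => s' As'; apply: AB; split=> //=.
  exact: nbhs_singleton nB.
elim: n u => [//|n IH] u [du cx _]; exists (fun s' => dpx u (s', t)).
  by move: nearU; apply: filterS => s' Us'; apply: has_diff_slice_x; exact: du.
exact: IH.
Qed.

Lemma smooth_near_diff u P : smooth_near u P -> differentiable u P.
Proof. by move=> [U [_ UP /(_ 1%N)[du _ _]]]; exact: du. Qed.

End Slices.

(** * The group action on jets *)

Section Transform.
Context {R : realType}.

Lemma near_forall_leq n (P : nat -> R -> Prop) (x : R) :
  (forall j, (j <= n)%N -> \forall y \near x, P j y) ->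
  \forall y \near x, forall j, (j <= n)%N -> P j y.
Proof.
elim: n => [|n IH] H.
  by apply: filterS (H 0%N isT) => y P0 j; rewrite leqn0 => /eqP ->.
apply: filterS2 (IH (fun j jn => H j (leqW jn))) (H n.+1 (leqnn _)) => y Pn PSn j.
by rewrite leq_eqVlt ltnS => /orP[/eqP ->|/Pn].
Qed.

Lemma dsch_total i (q : nat -> R) (l : R) : (i <= 3)%N ->
  dsch i q (fun j => l * (q j.+1 - q 2%N * q j)) = l * sch i.+1 q.
Proof. by case: i => [|[|[|[|//]]]] _ /=; field. Qed.

(** Used with [m = 1] for derivatives in the new variable, and with [m = dx/dy] for old derivatives
    evaluated at [x = N y]. *)
Lemma has_diff_sch_curve i (B : nat -> R -> R) (m y : R) : (i <= 3)%N ->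
  B 1%N y != 0 ->
  (forall j, (j <= 7)%N -> has_diff (B j) y (fun h => h * (m * B j.+1 y))) ->
  has_diff (fun y => sch i (fun j => B j y / B 1%N y)) y
    (fun h => h * (m * sch i.+1 (fun j => B j y / B 1%N y))).
Proof.
move=> i3 B1 dB; have dq j : (j <= 7)%N -> has_diff (fun y => B j y / B 1%N y) y
    (fun h => h * m * (B j.+1 y / B 1%N y - B 2%N y / B 1%N y * (B j y / B 1%N y))).
  move=> j7.
  apply: has_diff_eq (has_diffM (dB j j7) (has_diffV B1 (dB 1%N isT))) _ => h /=.
  by field.
apply: has_diff_eq (has_diff_sch i dq) _ => h /=.
by rewrite dsch_total // mulrA.
Qed.

(* How [S_{kx}] changes under [x |-> (ga1 x + de1) / (ga2 x + de2)], with
   [w = ga2 x + de2] and [c = ga2]. *)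
Definition transformed_S (w c : R) (S : nat -> R) (k : nat) : R :=
  match k with
  | 0 => w ^+ 4 * S 0%N
  | 1 => w ^+ 6 * S 1%N + 4 * c * w ^+ 5 * S 0%N
  | 2 => w ^+ 8 * S 2%N + 10 * c * w ^+ 7 * S 1%N + 20 * c ^+ 2 * w ^+ 6 * S 0%N
  | 3 => w ^+ 10 * S 3%N + 18 * c * w ^+ 9 * S 2%N
         + 90 * c ^+ 2 * w ^+ 8 * S 1%N + 120 * c ^+ 3 * w ^+ 7 * S 0%N
  | _ => w ^+ 12 * S 4%N + 28 * c * w ^+ 11 * S 3%N
         + 252 * c ^+ 2 * w ^+ 10 * S 2%N + 840 * c ^+ 3 * w ^+ 9 * S 1%N
         + 840 * c ^+ 4 * w ^+ 8 * S 0%N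
  end.

(** The finite counterpart of [d_om_projective]: powers of [w] cancel by homogeneity, and the terms
    in [c] by the choice of the rational coefficients. *)
Lemma om_transformed i (r w c : R) (S : nat -> R) : w != 0 -> S 0%N != 0 ->
  om i (r / w ^+ 2) (transformed_S w c S) = om i r S.
Proof.
move=> w0 S0; have w4S : w ^+ 4 * S 0%N != 0 by rewrite mulf_neq0 ?expf_neq0.
by case: i => [|[|[|i]]]; rewrite /om /om_weight /om_base /= ?nth_nil;
  field; rewrite ?w0 ?S0.
Qed.

(* The second and third derivatives of [(a u + b) / (c u + d)] with respect to
   [y], for a function [u] of [x = (e2 y - e1) / (g1 - g y)], where both
   determinants are 1, [n = 1 / (c u + d)], [k = 1 / (g1 - g y)] and
   [ai = u_{ix}]; then [dx/dy = k^2], [dk/dy = g k^2], [dn/dy = - c n^2 k^2 a1]. *)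
Definition second_derivative (c g n k a1 a2 : R) :=
  - (2 * c * (n ^+ 3 * k ^+ 4 * a1 ^+ 2)) + 2 * g * (n ^+ 2 * k ^+ 3 * a1)
  + n ^+ 2 * k ^+ 4 * a2.

Definition third_derivative (c g n k a1 a2 a3 : R) :=
  6 * c ^+ 2 * (n ^+ 4 * k ^+ 6 * a1 ^+ 3)
  - 12 * c * g * (n ^+ 3 * k ^+ 5 * a1 ^+ 2)
  - 6 * c * (n ^+ 3 * k ^+ 6 * a1 * a2)
  + 6 * g ^+ 2 * (n ^+ 2 * k ^+ 4 * a1)
  + 6 * g * (n ^+ 2 * k ^+ 5 * a2) + n ^+ 2 * k ^+ 6 * a3.

Lemma third_derivative_near (c g y : R) (n k a1 a2 a3 : R -> R) :
  deriv_near y n (fun y => - c * n y ^+ 2 * (k y ^+ 2 * a1 y)) ->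
  deriv_near y k (fun y => g * k y ^+ 2) ->
  deriv_near y a1 (fun y => k y ^+ 2 * a2 y) ->
  deriv_near y a2 (fun y => k y ^+ 2 * a3 y) ->
  deriv_near y (fun y => second_derivative c g (n y) (k y) (a1 y) (a2 y))
    (fun y => third_derivative c g (n y) (k y) (a1 y) (a2 y) (a3 y)).
Proof.
move=> dn dk da1; apply: filterS3 (filterI dn dk) da1 => t [dnt dkt] da1t da2t.
apply: has_diff_eq; first by rewrite /second_derivative; solve_has_diff.
by move=> h /=; rewrite /third_derivative; ring.
Qed.

(** In the new variable [w' = c w^2] and [(S j)' = w^2 S (j + 1)]. Iterating these rules from
    [w^4 S] produces the coefficients 4; 10, 20; 18, 90, 120; and so on. *)
Lemma transformed_S_step i (c y : R) (w : R -> R) (S : nat -> R -> R) :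
  (i <= 3)%N -> has_diff w y (fun h => h * (c * w y ^+ 2)) ->
  (forall j, (j <= 3)%N -> has_diff (S j) y (fun h => h * (w y ^+ 2 * S j.+1 y))) ->
  has_diff (fun y => transformed_S (w y) c (S^~ y) i) y
    (fun h => h * transformed_S (w y) c (S^~ y) i.+1).
Proof.
move=> + dw dS; have [d0 d1 d2 d3] :=
  And4 (dS 0%N isT) (dS 1%N isT) (dS 2%N isT) (dS 3%N isT).
by case: i => [|[|[|[|//]]]] _; (apply: has_diff_eq;
  [rewrite /=; solve_has_diff | move=> h /=; ring]).
Qed.

Variables (a b c d g1 e1 g2 e2 : R) (f : R -> R) (y0 : R).
Let N := mobius e2 (- e1) (- g2) g1.
Let x0 := N y0.
Hypotheses (det_abcd : a * d - c * b = 1) (det_ge : g1 * e2 - g2 * e1 = 1).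
Hypotheses (den_y0 : - g2 * y0 + g1 != 0) (den_u : c * f x0 + d != 0)
  (f1 : derive1n 1 f x0 != 0) (cf : forall n, cn n f x0).

(** [y] is the new variable, [x = N y] the old one and [F] the transformed function. Then
    [dx/dy = k^2], [nn] is the inverse denominator of the map acting on [u], [A i] is the old [i]-th
    derivative at [N y] and [G i] the new one. *)
Let F y := mobius a b c d (f (N y)).
Let k y := (- g2 * y + g1)^-1.
Let nn y := (c * f (N y) + d)^-1.
Let A i y := derive1n i f (N y).
Let G i y := derive1n i F y.

Let dk : deriv_near y0 k (fun y => g2 * k y ^+ 2).
Proof.
have := near_lin_neq0 den_y0; apply: filterS => y yb.
have D := has_diffD (has_diffM (has_diff_cst (- g2) y) (has_diff_id y))
  (has_diff_cst g1 y).
have E := has_diffV (f := fun t => - g2 * t + g1) yb D.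
by apply: has_diff_eq E _ => h /=; rewrite /k; field.
Qed.

Let dN : deriv_near y0 N (fun y => k y ^+ 2).
Proof.
have dn := near_lin_neq0 den_y0; near=> y.
have yb : - g2 * y + g1 != 0 by near: y.
have dky : has_diff k y (fun h => h * (g2 * k y ^+ 2)) by near: y; exact: dk.
have D := has_diffD (has_diffM (has_diff_cst e2 y) (has_diff_id y))
  (has_diff_cst (- e1) y).
apply: has_diff_eq (has_diffM D dky) _ => h /=.
transitivity (h * (g1 * e2 - g2 * e1) * k y ^+ 2); last by rewrite det_ge mulr1.
by rewrite /k; field.
Unshelve. all: by end_near. Qed.

Let dA i : deriv_near y0 (A i) (fun y => k y ^+ 2 * A i.+1 y).
Proof. by apply: deriv_near_comp dN _; exact: cn_derive1n (cf i.+1) _. Qed.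

Let near_den : \forall y \near y0, c * A 0 y + d != 0.
Proof.
have dA0 := nbhs_singleton (dA 0).
have D := has_diffD (has_diffM (has_diff_cst c y0) dA0) (has_diff_cst d y0).
exact: has_diff_neq0 D den_u.
Qed.

Let dnn : deriv_near y0 nn (fun y => - c * nn y ^+ 2 * (k y ^+ 2 * A 1 y)).
Proof.
have den := near_den; have dA0 := dA 0; near=> y.
have yb : c * A 0 y + d != 0 by near: y.
have dAy : has_diff (A 0) y (fun h => h * (k y ^+ 2 * A 1 y)) by near: y.
have D := has_diffD (has_diffM (has_diff_cst c y) dAy) (has_diff_cst d y).
have E := has_diffV (f := fun t => c * A 0 t + d) yb D.
apply: has_diff_eq E _ => h /=; rewrite /nn (_ : f (N y) = A 0 y) //.
by field.
Unshelve. all: by end_near. Qed.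

Let cF n : cn n F y0.
Proof.
apply: (@cn_comp _ n (fun y => f (N y)) (mobius a b c d)); last exact: cn_mobius.
by apply: cn_comp => //; exact: cn_mobius.
Qed.

Let dG i : deriv_near y0 (G i) (G i.+1).
Proof. exact: cn_derive1n (cF i.+1) _. Qed.

Let E1 y := nn y ^+ 2 * k y ^+ 2 * A 1 y.
Let E2 y := second_derivative c g2 (nn y) (k y) (A 1 y) (A 2 y).
Let E3 y := third_derivative c g2 (nn y) (k y) (A 1 y) (A 2 y) (A 3 y).

Let G1E : \forall y \near y0, G 1 y = E1 y.
Proof.
apply: (deriv_near_unique (dG 0) _ (g := F)); last by near=> y.
have den := near_den; have dA0 := dA 0; have dn := dnn; near=> y.
have yb : c * A 0 y + d != 0 by near: y.
have dAy : has_diff (A 0) y (fun h => h * (k y ^+ 2 * A 1 y)) by near: y.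
have dny : has_diff nn y (fun h => h * (- c * nn y ^+ 2 * (k y ^+ 2 * A 1 y))).
  by near: y.
have D := has_diffD (has_diffM (has_diff_cst a y) dAy) (has_diff_cst b y).
apply: has_diff_eq (has_diffM D dny) _ => h /=.
transitivity (h * (a * d - c * b) * E1 y); last by rewrite det_abcd mulr1.
by rewrite /E1 /nn (_ : f (N y) = A 0 y) //; field.
Unshelve. all: by end_near. Qed.

Let G2E : \forall y \near y0, G 2 y = E2 y.
Proof.
apply: (deriv_near_unique (dG 1) _ G1E).
have dn := dnn; have dk' := dk; have dA1 := dA 1; near=> y.
have dny : has_diff nn y (fun h => h * (- c * nn y ^+ 2 * (k y ^+ 2 * A 1 y))).
  by near: y.
have dky : has_diff k y (fun h => h * (g2 * k y ^+ 2)).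
  by near: y; exact: dk'.
have dA1y : has_diff (A 1) y (fun h => h * (k y ^+ 2 * A 2 y)).
  by near: y; exact: dA1.
have D := has_diffM (has_diffM (has_diffX 2 dny) (has_diffX 2 dky)) dA1y.
by apply: has_diff_eq D _ => h /=; rewrite /E2 /second_derivative; ring.
Unshelve. all: by end_near. Qed.

Let G3E : \forall y \near y0, G 3 y = E3 y.
Proof.
apply: (deriv_near_unique (dG 2) _ G2E).
exact: third_derivative_near dnn dk (dA 1) (dA 2).
Qed.

Let SA i y := sch i (fun j => A j y / A 1 y).
Let SG i y := sch i (fun j => G j y / G 1 y).

Let near_A1 : \forall y \near y0, A 1 y != 0.
Proof. exact: has_diff_neq0 (nbhs_singleton (dA 1)) f1. Qed.

Let near_k : \forall y \near y0, k y != 0.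
Proof.
by have := near_lin_neq0 den_y0; apply: filterS => y; rewrite invr_eq0.
Qed.

Let near_n : \forall y \near y0, nn y != 0.
Proof. by have := near_den; apply: filterS => y; rewrite invr_eq0. Qed.

Let near_G1 : \forall y \near y0, G 1 y != 0.
Proof.
have hE := G1E; have hA := near_A1; have hk := near_k; have hn := near_n.
near=> y; have -> : G 1 y = E1 y by near: y.
have k0 : k y != 0 by near: y.
have n0 : nn y != 0 by near: y.
have A0 : A 1 y != 0 by near: y.
by rewrite !mulf_neq0 ?expf_neq0.
Unshelve. all: by end_near. Qed.

Let dSA i : (i <= 3)%N -> deriv_near y0 (SA i) (fun y => k y ^+ 2 * SA i.+1 y).
Proof.
move=> i3; have hA := near_A1.
have hD : \forall y \near y0, forall j, (j <= 7)%N ->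
    has_diff (A j) y (fun h => h * (k y ^+ 2 * A j.+1 y)).
  by apply: near_forall_leq => j _; exact: dA.
near=> y; apply: has_diff_sch_curve => //; first by near: y.
by near: y.
Unshelve. all: by end_near. Qed.

Let dSG i : (i <= 3)%N -> deriv_near y0 (SG i) (SG i.+1).
Proof.
move=> i3; have hG := near_G1.
have hD : \forall y \near y0, forall j, (j <= 7)%N ->
    has_diff (G j) y (fun h => h * (1 * G j.+1 y)).
  apply: near_forall_leq => j _; have := dG j; apply: filterS => y.
  by rewrite mul1r.
near=> y.
have D : has_diff (SG i) y (fun h => h * (1 * SG i.+1 y)).
  apply: has_diff_sch_curve => //; first by near: y.
  by near: y.
by apply: has_diff_eq D _ => h; rewrite mul1r.
Unshelve. all: by end_near. Qed.

(** The chain rule for the Schwarzian: a Moebius map of [u] leaves it unchanged, one of [x]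
    multiplies it by [(dx/dy)^2 = k^4]. Only this case uses the explicit first three derivatives;
    [SG_step] differentiates it. *)
Let SG0 : \forall y \near y0, SG 0 y = transformed_S (k y) g2 (SA^~ y) 0.
Proof.
apply: filterS3 (filterI near_n near_k) (filterI near_A1 G1E) (filterI G2E G3E).
move=> y [n0 k0] [A0 e1'] [e2' e3'].
rewrite -[LHS]/(G 3 y / G 1 y - 3 / 2 * (G 2 y / G 1 y) ^+ 2).
rewrite -[RHS]/(k y ^+ 4 * (A 3 y / A 1 y - 3 / 2 * (A 2 y / A 1 y) ^+ 2)).
rewrite e1' e2' e3' /E1 /E2 /E3 /second_derivative /third_derivative.
move: (nn y) (k y) (A 1 y) (A 2 y) (A 3 y) n0 k0 A0 => n' k' a1 a2 a3 n0 k0 A0.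
by field; rewrite n0 k0 A0.
Qed.

Let SG_step i : (i <= 3)%N ->
  (\forall y \near y0, SG i y = transformed_S (k y) g2 (SA^~ y) i) ->
  \forall y \near y0, SG i.+1 y = transformed_S (k y) g2 (SA^~ y) i.+1.
Proof.
move=> i3 IH; apply: (deriv_near_unique (dSG i3) _ IH).
apply: filterS2 dk (near_forall_leq dSA) => y dky hD.
exact: transformed_S_step.
Qed.

Lemma transform_jet :
  [/\ derive1n 1 F y0 = E1 y0, derive1n 2 F y0 = E2 y0 &
    forall i, (i <= 4)%N -> sch i (fun j => derive1n j F y0 / derive1n 1 F y0) =
      transformed_S (k y0) g2
        (fun i => sch i (fun j => derive1n j f x0 / derive1n 1 f x0)) i].
Proof.
split; [exact: nbhs_singleton G1E|exact: nbhs_singleton G2E|].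
have H i : (i <= 4)%N ->
    \forall y \near y0, SG i y = transformed_S (k y) g2 (SA^~ y) i.
  by elim: i => [_|i IH i4]; [exact: SG0|apply: SG_step => //; exact/IH/ltnW].
by move=> i /H /nbhs_singleton.
Qed.

End Transform.

(** * Realizing jets by polynomials *)

Section Realization.
Context {R : realType}.

(** A part affine in [t] suffices: [u_t] is the only [t]-derivative of [u] in [jcoord]. *)
Definition poly_fun (q : {poly R}) (c : R) (P : R * R) : R := q.[P.1] + c * P.2.

Lemma differentiable_poly_fun q c P : differentiable (poly_fun q c) P.
Proof.
apply: differentiableD.
  apply: (@differentiable_comp _ _ _ _ fst (horner q)).
    by apply: linear_differentiable => Q; exact: cvg_fst.
  by apply/derivable1_diffP; exact: derivable_horner.
apply: differentiableM; first exact: differentiable_cst.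
by apply: linear_differentiable => Q; exact: cvg_snd.
Qed.

Lemma dpx_poly_fun q c : dpx (poly_fun q c) = poly_fun q^`() 0.
Proof.
apply/funext => -[s t]; rewrite dpxE derive1E.
have dq : has_diff (horner q) s (fun h => h * q^`().[s]).
  by apply/has_diff1; exact: is_derive_poly.
have D := has_diffD dq (has_diff_cst (c * t) s).
have [_ ->] : is_derive s 1 (fun s' => poly_fun q c (s', t)) q^`().[s].
  by apply/has_diff1; apply: has_diff_eq D _ => h; rewrite addr0.
by rewrite /poly_fun /= mul0r addr0.
Qed.

Lemma dpt_poly_fun q c : dpt (poly_fun q c) = poly_fun c%:P 0.
Proof.
apply/funext => -[s t]; rewrite dptE derive1E.
have D := has_diffD (has_diff_cst q.[s] t)
  (has_diffM (has_diff_cst c t) (has_diff_id t)).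
have [_ ->] : is_derive t 1 (fun t' => poly_fun q c (s, t')) c.
  by apply/has_diff1; apply: has_diff_eq D _ => h /=; ring.
by rewrite /poly_fun /= hornerC mul0r addr0.
Qed.

Lemma smooth_poly_fun q c P : smooth_near (poly_fun q c) P.
Proof.
exists setT; split=> //; first exact: openT.
move=> n; elim: n q c => [|n IH] q c.
  by move=> Q _; exact/differentiable_continuous/differentiable_poly_fun.
split; last 2 first.
- by rewrite dpx_poly_fun; exact: IH.
- by rewrite dpt_poly_fun; exact: IH.
by move=> Q _; exact: differentiable_poly_fun.
Qed.

Lemma iter_dpx_poly_fun k q c : (0 < k)%N ->
  iter k dpx (poly_fun q c) = poly_fun q^`(k) 0.
Proof.
case: k => [//|k] _; elim: k => [|k IH]; first by rewrite /= dpx_poly_fun.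
by rewrite iterS IH dpx_poly_fun -derivnS.
Qed.

Lemma poly_with_derivatives n (a : nat -> R) x :
  exists q : {poly R}, forall k, (k < n)%N -> q^`(k).[x] = a k.
Proof.
pose p := \poly_(i < n) (a i / i`!%:R); exists (p \Po ('X - x%:P)) => k kn.
have -> : (p \Po ('X - x%:P))^`(k) = p^`(k) \Po ('X - x%:P).
  elim: k {kn} => [//|k IH].
  by rewrite !derivnS IH deriv_comp derivXsubC mulr1.
rewrite horner_comp hornerXsubC subrr horner_coef0 coef_derivn addn0 ffactnn.
by rewrite coef_poly kn -[LHS]mulr_natr mulfVK.
Qed.

Lemma jet_realization (y : 'rV[R]_11) : exists u P,
  smooth_near u P /\ jcoord (jet_of u P) = y.
Proof.
pose P := (co 0 y, co 1 y).
(* The linear part contributes [co 3 y * co 1 y] to the value of [u] at [P], so this is subtracted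
   from the constant term. *)
pose a k := if k is 0 then co 2 y - co 3 y * co 1 y else co (3 + k) y.
have [q qE] := poly_with_derivatives 8 a (co 0 y).
exists (poly_fun q (co 3 y)), P; split; first exact: smooth_poly_fun.
have E k : (0 < k <= 7)%N -> ju (jet_of (poly_fun q (co 3 y)) P) k 0 = co (3 + k) y.
  move=> /andP[k0 k7]; rewrite /= iter_dpx_poly_fun // /poly_fun mul0r addr0 qE //.
  by case: k k0 {k7}.
apply: rowP_co => k k10; rewrite co_jcoord // /jcoord_seq.
rewrite !(E 1%N, E 2%N, E 3%N, E 4%N, E 5%N, E 6%N, E 7%N) //.
case: k k10 => [|[|[|[|k]]]] k10 //=.
- have q0 : q.[co 0 y] = a 0%N := qE 0%N isT.
  by rewrite /poly_fun /P /= q0 /a subrK.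
- by rewrite dpt_poly_fun /poly_fun hornerC mul0r addr0.
by do 7?[case: k k10 => [|k] k10; [by []|]].
Qed.

End Realization.

(** * Finite transformations of jets and of the invariants *)

Section Action.
Context {R : realType}.
Implicit Types (g : @transf R) (u : R * R -> R) (P : R * R).

Lemma SS_jet (z : jet R) k : (k <= 4)%N ->
  SS (jcoord z) k = sch k (fun j => ju z j 0 / ju z 1 0).
Proof.
by case: k => [|[|[|[|[|//]]]]] _; rewrite /SS /sch /qs !co_jcoord.
Qed.

Lemma eq_transformed_S (w c : R) (S S' : nat -> R) i : (i <= 4)%N ->
  (forall k, (k <= 4)%N -> S k = S' k) ->
  transformed_S w c S i = transformed_S w c S' i.
Proof. by move=> + SE; case: i => [|[|[|[|[|//]]]]] _ /=; rewrite !SE. Qed.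

Lemma has_diff_mobius (a b c d x v' : R) (v : R -> R) : c * v x + d != 0 ->
  has_diff v x (fun h => h * v') ->
  has_diff (fun y => mobius a b c d (v y)) x
    (fun h => h * ((a * d - c * b) * v' / (c * v x + d) ^+ 2)).
Proof.
move=> cd dv.
have D1 := has_diffD (has_diffM (has_diff_cst a x) dv) (has_diff_cst b x).
have D2 := has_diffD (has_diffM (has_diff_cst c x) dv) (has_diff_cst d x).
have D3 := has_diffV (f := fun t => c * v t + d) cd D2.
by apply: has_diff_eq (has_diffM D1 D3) _ => h /=; field.
Qed.

Section Jet.
Variables (g : @transf R) (u : R * R -> R) (P : R * R).
Hypotheses (uP : smooth_near u P) (denx : ga2 g * P.1 + de2 g != 0)
  (denu : al2 g * u P + be2 g != 0).
Let z := jet_of u P.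
Let z' := jet_of (act_fun g u) (act_point g P).
Let w := ga2 g * P.1 + de2 g.
Let n := (al2 g * u P + be2 g)^-1.
Hypothesis z1 : ju z 1 0 != 0.

Let y0 := mobius (ga1 g) (de1 g) (ga2 g) (de2 g) P.1.
Let f (s : R) := u (s, P.2).

(** By [det_x] the denominators of a map and of its inverse at corresponding points are reciprocal;
    so the [k] of [transform_jet] is [w] here. *)
Let den_y0 : - ga2 g * y0 + ga1 g = w^-1.
Proof.
transitivity ((ga1 g * de2 g - ga2 g * de1 g) / w); last by rewrite det_x mul1r.
by rewrite /y0 /mobius /w; field.
Qed.

Let inv_y0 : mobius (de2 g) (- de1 g) (- ga2 g) (ga1 g) y0 = P.1.
Proof.
rewrite /mobius den_y0 invrK.
transitivity (P.1 * (ga1 g * de2 g - ga2 g * de1 g)); last by rewrite det_x mulr1.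
by rewrite /y0 /mobius /w; field.
Qed.

Let fP : f P.1 = u P.
Proof. by rewrite /f -surjective_pairing. Qed.

Let aP k : derive1n k f P.1 = ju z k 0.
Proof. by rewrite /f -iter_dpxE -surjective_pairing. Qed.

Let bP k : derive1n k (fun y => mobius (al1 g) (be1 g) (al2 g) (be2 g)
    (f (mobius (de2 g) (- de1 g) (- ga2 g) (ga1 g) y))) y0 = ju z' k 0.
Proof.
rewrite /= /act_point iter_dpxE; congr (derive1n k _ _).
by apply/funext => y; rewrite /act_fun /= addrK.
Qed.

Lemma act_jet0 : ju z' 0 0 = mobius (al1 g) (be1 g) (al2 g) (be2 g) (u P).
Proof. by rewrite -(bP 0) /= inv_y0 fP. Qed.

Lemma act_jet :
  [/\ ju z' 1 0 = n ^+ 2 * w ^+ 2 * ju z 1 0,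
      ju z' 2 0 = second_derivative (al2 g) (ga2 g) n w (ju z 1 0) (ju z 2 0),
      ju z' 0 1 = n ^+ 2 * ju z 0 1 &
      forall i, (i <= 4)%N ->
        SS (jcoord z') i = transformed_S w (ga2 g) (SS (jcoord z)) i].
Proof.
have dy0 : - ga2 g * y0 + ga1 g != 0 by rewrite den_y0 invr_eq0.
have du : al2 g * f (mobius (de2 g) (- de1 g) (- ga2 g) (ga1 g) y0) + be2 g != 0.
  by rewrite inv_y0 fP.
have uP' : smooth_near u (P.1, P.2) by rewrite -surjective_pairing.
have f1 : derive1n 1 f (mobius (de2 g) (- de1 g) (- ga2 g) (ga1 g) y0) != 0.
  by rewrite inv_y0 aP.
have cf k : cn k f (mobius (de2 g) (- de1 g) (- ga2 g) (ga1 g) y0).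
  by rewrite inv_y0; exact: smooth_near_slice uP'.
have det_u' : al1 g * be2 g - al2 g * be1 g = 1 by exact: det_u.
have [E1 E2 E3] := transform_jet det_u' (det_x g) dy0 du f1 cf.
move: E1 E2 E3; rewrite !inv_y0 fP den_y0 invrK !aP !bP => E1 E2 E3.
split=> //; last first.
  move=> i i4; rewrite SS_jet //.
  have bE : (fun j => ju z' j 0 / ju z' 1 0) = fun j => derive1n j
     (fun y => mobius (al1 g) (be1 g) (al2 g) (be2 g)
       (f (mobius (de2 g) (- de1 g) (- ga2 g) (ga1 g) y))) y0 / ju z' 1 0.
    by apply/funext => j; rewrite bP.
  have aE : (fun j => derive1n j f P.1 / ju z 1 0) = fun j => ju z j 0 / ju z 1 0.
    by apply/funext => j; rewrite aP.
  rewrite bE (E3 i i4) aE; apply: eq_transformed_S => // k k4.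
  by rewrite SS_jet.
rewrite [LHS]/= /act_point dptE /act_fun /= inv_y0.
have du0 := has_diff_slice_t (smooth_near_diff uP').
have ds : has_diff (fun t => t - eps g) (P.2 + eps g) (fun h => h * 1).
  have D := has_diffD (has_diff_id (P.2 + eps g)) (has_diff_cst (- eps g) _).
  by apply: has_diff_eq D _ => h; rewrite mulr1 addr0.
have dt : has_diff (fun t => u (P.1, t - eps g)) (P.2 + eps g)
    (fun h => h * (1 * dpt u (P.1, P.2))).
  by apply: (has_diff_compR (h := fun t => u (P.1, t)) ds); rewrite addrK.
have cd : al2 g * u (P.1, P.2 + eps g - eps g) + be2 g != 0.
  by rewrite addrK -surjective_pairing.
have /has_diff1 [_] := has_diff_mobius (al1 g) (be1 g) cd dt.
rewrite derive1E => ->; rewrite addrK -surjective_pairing det_u' !mul1r.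
by rewrite /n exprVn mulrC.
Qed.

End Jet.

Lemma rr_transformed (z z' : jet R) (n w : R) : n != 0 -> w != 0 ->
  ju z 1 0 != 0 -> ju z' 1 0 = n ^+ 2 * w ^+ 2 * ju z 1 0 ->
  ju z' 0 1 = n ^+ 2 * ju z 0 1 ->
  rr (jcoord z') = rr (jcoord z) / w ^+ 2.
Proof.
move=> n0 w0 z1 E1 Et; rewrite /rr !co_jcoord //= E1 Et.
by field; rewrite z1 w0 n0.
Qed.

Lemma omega_transformed (z z' : jet R) (n w c : R) : n != 0 -> w != 0 ->
  ju z 1 0 != 0 -> SS (jcoord z) 0 != 0 ->
  ju z' 1 0 = n ^+ 2 * w ^+ 2 * ju z 1 0 ->
  ju z' 0 1 = n ^+ 2 * ju z 0 1 ->
  (forall i, (i <= 4)%N ->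
     SS (jcoord z') i = transformed_S w c (SS (jcoord z)) i) ->
  omega z' = omega z.
Proof.
move=> n0 w0 z1 S0 E1 Et ES.
have z1' : ju z' 1 0 != 0 by rewrite E1 !mulf_neq0 ?expf_neq0.
apply/rowP => i; rewrite !omegaE //.
rewrite /Om -(om_transformed i (rr _) c w0 S0) (rr_transformed n0 w0 z1 E1 Et).
by rewrite /om; congr (_ * _); case: i => [[|[|[|[|//]]]] i4]; rewrite /= !ES.
Qed.

Lemma omega_act g u P : smooth_near u P -> ga2 g * P.1 + de2 g != 0 ->
  al2 g * u P + be2 g != 0 -> omega_dom (jet_of u P) ->
  omega (jet_of (act_fun g u) (act_point g P)) = omega (jet_of u P).
Proof.
move=> uP denx denu /omega_domP [z1 S0].
have [E1 _ Et ES] := act_jet uP denx denu z1.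
have n0 : (al2 g * u P + be2 g)^-1 != 0 by rewrite invr_eq0.
exact: omega_transformed n0 denx z1 S0 E1 Et ES.
Qed.

Lemma omega_invariant (Psi : 'rV[R]_4 -> R) :
  invariant_pde omega_dom (fun z => Psi (omega z)).
Proof. by move=> g u P uP denx denu Dz Fz; rewrite omega_act. Qed.

End Action.

(** * Invariant equations *)

Section Transitivity.
Context {R : realType}.
Implicit Types (z : jet R).

(** Prescribing the denominator gives [d = w - c x], the image gives [b = x' w - a x], and the
    determinant condition becomes [a w - c x' w = 1], whence [a]. *)
Lemma mobius_through (x x' w c : R) : w != 0 -> exists a b d,
  [/\ a * d - c * b = 1, c * x + d = w & mobius a b c d x = x'].
Proof.
move=> w0; pose a := (1 + c * x' * w) / w.
exists a, (x' * w - a * x), (w - c * x).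
have cd : c * x + (w - c * x) = w by ring.
by split=> //; rewrite ?/mobius ?cd /a; field.
Qed.

Lemma chart_inj z z' : jreg (jcoord z) -> jreg (jcoord z') ->
  jx z = jx z' -> jt z = jt z' -> ju z 0 0 = ju z' 0 0 ->
  ju z 1 0 = ju z' 1 0 -> ju z 2 0 = ju z' 2 0 ->
  SS (jcoord z) 1 = SS (jcoord z') 1 -> rr (jcoord z) = rr (jcoord z') ->
  omega z = omega z' -> jcoord z = jcoord z'.
Proof.
move=> yr yr' e0 e1 e2 e3 e4 e5 e6 eo; rewrite -(chartK yr) -(chartK yr').
have z1 : ju z 1 0 != 0 by case: yr => + _ _; rewrite co4_jcoord.
have z1' : ju z' 1 0 != 0 by rewrite -e3.
congr unchart; rewrite -(join_chart z1) -(join_chart z1') eo.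
apply: rowP_co => k k10; rewrite !co_rv //= e5 e6 !co_jcoord //=.
by rewrite e0 e1 e2 e3 e4.
Qed.

Lemma join_inj (c c' : 'rV[R]_11) (o o' : 'rV[R]_4) :
  join c o = join c' o' -> o = o'.
Proof.
move=> E; apply: rowP_co => k k3.
have coE b (p : 'rV[R]_4) : co (7 + k) (join b p) = co k p.
  by rewrite co_rv; [case: k k3 => [|[|[|[|]]]] | lia].
by rewrite -(coE c) E coE.
Qed.

Lemma mulr_gt0_trans (a b c : R) : 0 < a * b -> 0 < a * c -> 0 < b * c.
Proof.
move=> ab ac; have a2 : 0 < a ^+ 2.
  by rewrite exprn_even_gt0 //=; move: ab; apply: contraTneq => ->; rewrite mul0r ltxx.
have E : a * b * (a * c) = a ^+ 2 * (b * c) by ring.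
by rewrite -(pmulr_rgt0 _ a2) -E mulr_gt0.
Qed.

Lemma pos_ratio (b c : R) : 0 < b * c -> 0 < b / c.
Proof.
move=> bc; have c0 : c != 0 by move: bc; apply: contraTneq => ->; rewrite mulr0 ltxx.
rewrite (_ : b / c = b * c / c ^+ 2); last by field.
by rewrite divr_gt0 // exprn_even_gt0.
Qed.

Lemma component_jcoord z0 z z' : regular z0 -> jcoord z = jcoord z' ->
  component z0 z -> component z0 z'.
Proof.
by move=> z0r E; rewrite !(component_chart _ z0r) E.
Qed.

Lemma omega_jcoord z z' : ju z 1 0 != 0 -> jcoord z = jcoord z' ->
  omega z = omega z'.
Proof.
move=> z1 E; have z1' : ju z' 1 0 != 0 by rewrite -co4_jcoord -E co4_jcoord.
by apply/rowP => i; rewrite !omegaE // E.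
Qed.

(* [m = ga2 x + de2] is found from [u_t / u_x], then [ga2] from [S_x],
   [nu = al2 u + be2] from [u_x], and [al2] from [u_xx]. *)
Lemma act_transitive (z' z0 : jet R) u P : regular z0 -> smooth_near u P ->
  component z0 (jet_of u P) -> component z0 z' ->
  omega (jet_of u P) = omega z' ->
  exists g, [/\ ga2 g * P.1 + de2 g != 0, al2 g * u P + be2 g != 0 &
    jcoord (jet_of (act_fun g u) (act_point g P)) = jcoord z'].
Proof.
move=> z0r uP zC zC' eo.
have [yr [h3 h6 _]] := (component_chart _ z0r).1 zC.
have [yr' [h3' h6' _]] := (component_chart _ z0r).1 zC'.
set z := jet_of u P in zC eo yr h3 h6.
have [y4 y3 S0] := yr; have [y4' y3' S0'] := yr'.
have z1 : ju z 1 0 != 0 by rewrite -co4_jcoord.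
move: h3 h6 h3' h6'; rewrite !co_rv // => h3 h6 h3' h6'.
(* Both jets lie in one component, so the quotients whose square roots define [m] and [nu] are
   positive. *)
have ratio_p := pos_ratio (mulr_gt0_trans h3 h3').
have ratio_r := pos_ratio (mulr_gt0_trans h6 h6').
rewrite {h3 h6 h3' h6'}/= in ratio_p ratio_r.
rewrite !co4_jcoord in ratio_p.
pose m := Num.sqrt (rr (jcoord z) / rr (jcoord z')).
have m_gt0 : 0 < m by rewrite sqrtr_gt0.
have m2 : m ^+ 2 = rr (jcoord z) / rr (jcoord z') by rewrite sqr_sqrtr // ltW.
have m0 : m != 0 by rewrite gt_eqF.
(* Solution of [m^6 S_x + 4 c m^5 S = S_x'], possible since [S] is nonzero. *)
pose c := (SS (jcoord z') 1 - m ^+ 6 * SS (jcoord z) 1)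
  / (4 * m ^+ 5 * SS (jcoord z) 0).
have [a1 [b1 [d1 [detx wE xE]]]] := mobius_through P.1 (jx z') c m0.
pose nu := Num.sqrt (m ^+ 2 * (ju z 1 0 / ju z' 1 0)).
have nu_gt0 : 0 < nu by rewrite sqrtr_gt0 mulr_gt0 // exprn_gt0.
have nu2 : nu ^+ 2 = m ^+ 2 * (ju z 1 0 / ju z' 1 0).
  by rewrite sqr_sqrtr // mulr_ge0 // ?exprn_ge0 // ltW.
have nu0 : nu != 0 by rewrite gt_eqF.
(* Solution of [second_derivative al c nu^-1 m u_x u_xx = u_xx'], which is linear in [al]. *)
pose al := (2 * c * (nu^-1 ^+ 2 * m ^+ 3 * ju z 1 0)
   + nu^-1 ^+ 2 * m ^+ 4 * ju z 2 0 - ju z' 2 0)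
  / (2 * nu^-1 ^+ 3 * m ^+ 4 * ju z 1 0 ^+ 2).
have [a2 [b2 [d2 [detu nE uE]]]] := mobius_through (u P) (ju z' 0 0) al nu0.
exists (Transf (jt z' - P.2) detu detx); set g := Transf _ _ _.
have denx : ga2 g * P.1 + de2 g != 0 by rewrite /= wE.
have denu : al2 g * u P + be2 g != 0 by rewrite /= nE.
have [E1 E2 Et ES] := act_jet uP denx denu z1.
have E0 : ju (jet_of (act_fun g u) (act_point g P)) 0 0 =
    mobius (al1 g) (be1 g) (al2 g) (be2 g) (u P) by exact: act_jet0.
have Ex : jx (jet_of (act_fun g u) (act_point g P)) = jx z' by exact: xE.
have Ep : jt (jet_of (act_fun g u) (act_point g P)) = jt z'.
  by rewrite /= addrC subrK.
split=> //.
have eo' : omega (jet_of (act_fun g u) (act_point g P)) = omega z'.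
  by rewrite -eo; apply: omega_act => //; apply/omega_domP.
rewrite -/z in E1 E2 Et ES.
move: (jet_of (act_fun g u) (act_point g P)) eo' E0 E1 E2 Et ES Ex Ep => t.
clearbody z; rewrite /= nE wE uE => eo' E0 E1 E2 Et ES Ex Ep.
have z1' : ju z' 1 0 != 0 by rewrite -co4_jcoord.
have ut0 : ju z 0 1 != 0 by move: y3; rewrite co_jcoord.
have n0 : nu^-1 != 0 by rewrite invr_eq0.
have t1 : ju t 1 0 = ju z' 1 0.
  by rewrite E1 exprVn nu2; field; rewrite z1' z1 m0.
have tr : jreg (jcoord t).
  split; first by rewrite co4_jcoord t1.
    by rewrite co_jcoord // [nth _ _ _]Et mulf_neq0 // expf_neq0.
  by rewrite ES //= mulf_neq0 // expf_neq0.
apply: chart_inj => //.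
- rewrite E2 /second_derivative /al.
  by field; rewrite z1 m0 nu0.
- rewrite ES //= /c.
  by field; rewrite S0 m0.
have r'0 : rr (jcoord z') != 0 by rewrite mulf_neq0 ?invr_neq0.
have r0 : rr (jcoord z) != 0 by rewrite mulf_neq0 ?invr_neq0.
by rewrite (rr_transformed n0 m0 z1 E1 Et) m2 invf_div mulrC divfK.
Qed.

(** Invariance speaks of jets of functions, so [z] is replaced by the jet of a function with the
    same [jcoord]; [F], the component and the invariants depend on [jcoord] alone. *)
Lemma invariant_locus (F : 'rV[R]_11 -> R) z0 z z' : regular z0 ->
  invariant_pde (component z0) (fun z => F (jcoord z)) ->
  component z0 z -> component z0 z' -> omega z = omega z' ->
  F (jcoord z) = 0 -> F (jcoord z') = 0.
Proof.
move=> z0r Finv zC zC' eo Fz.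
have [u [P [uP uE]]] := jet_realization (jcoord z).
have uC : component z0 (jet_of u P) by exact: component_jcoord zC.
have z1 : ju z 1 0 != 0.
  by have [[+ _ _] _] := (component_chart _ z0r).1 zC; rewrite co4_jcoord.
have uo : omega (jet_of u P) = omega z' by rewrite -eo; exact/esym/omega_jcoord.
have [g [denx denu gE]] := act_transitive z0r uP uC zC' uo.
by rewrite -gE; apply: Finv => //; rewrite uE.
Qed.

(** The slice meets the orbit of [z] at a jet with the same invariants. [invariant_locus], applied
    in both directions, compares the vanishing of [F] at the two jets; their values may differ,
    hence an equivalence instead of an equality. *)
Lemma invariant_pde_form (F : 'rV[R]_11 -> R) (z0 : jet R) :
  regular z0 ->
  invariant_pde (component z0) (fun z => F (jcoord z)) ->
  exists Psi : 'rV[R]_4 -> R,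
    (forall z : jet R, component z0 z ->
       (F (jcoord z) = 0 <-> Psi (omega z) = 0)) /\
    ((forall z : jet R, component z0 z -> differentiable F (jcoord z)) ->
     forall z : jet R, component z0 z -> differentiable Psi (omega z)).
Proof.
move=> z0r Finv; pose c0 := chart (jcoord z0).
exists (fun o => F (unchart (join c0 o))); split=> [z zC|dF z zC].
  have sj := same_side_omega z0r zC.
  have jC := component_row_jet z0r sj.
  have z1 : ju z 1 0 != 0.
    by have [[+ _ _] _] := (component_chart _ z0r).1 zC; rewrite co4_jcoord.
  have jd := same_side_dom sj.
  have [j4 _ _] := unchart_jreg jd.
  have eo : omega (row_jet (unchart (join c0 (omega z)))) = omega z.
    have j1 : ju (row_jet (unchart (join c0 (omega z)))) 1 0 != 0.
      by rewrite -co4_jcoord row_jetK.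
    have := join_chart j1; rewrite row_jetK unchartK //; exact: join_inj.
  rewrite -[unchart _]row_jetK.
  by split; apply: (invariant_locus z0r Finv).
have sj := same_side_omega z0r zC.
apply: differentiable_section; first exact: same_side_dom sj.
by rewrite -[unchart _]row_jetK; apply: dF; exact: component_row_jet.
Qed.

End Transitivity.

Theorem mainTheorem1 (R : realType) :
  (* omega_1, ..., omega_4 satisfy the seven conditions *)
  (forall (j : 'I_7) (i : 'I_4) (z : jet R), omega_dom z ->
     prolong 7 (Zgen j) (fun y => omega y 0 i) z = 0) /\
  (* they are functionally independent *)
  (forall z : jet R, regular z -> differentials_free omega z) /\
  (* every solution of the seven conditions is locally a function of them *)
  (forall (w : 'rV[R]_11 -> R) (U : set 'rV[R]_11) (z0 : jet R),
     regular z0 -> open U -> U (jcoord z0) ->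
     (forall y, U y -> differentiable w y) ->
     (forall (j : 'I_7) (z : jet R), U (jcoord z) ->
        prolong 7 (Zgen j) (fun y => w (jcoord y)) z = 0) ->
     exists (V : set 'rV[R]_11) (Psi : 'rV[R]_4 -> R),
       [/\ open V, V (jcoord z0) &
           forall z : jet R, V (jcoord z) ->
             differentiable Psi (omega z) /\ w (jcoord z) = Psi (omega z)]) /\
  (* and globally so on each connected component of the regular jets *)
  (forall (w : 'rV[R]_11 -> R) (z0 : jet R),
     regular z0 ->
     (forall z : jet R, component z0 z -> differentiable w (jcoord z)) ->
     (forall (j : 'I_7) (z : jet R), component z0 z ->
        prolong 7 (Zgen j) (fun y => w (jcoord y)) z = 0) ->
     exists Psi : 'rV[R]_4 -> R,
       forall z : jet R, component z0 z ->
         differentiable Psi (omega z) /\ w (jcoord z) = Psi (omega z)) /\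
  (* Psi (omega_1, ..., omega_4) = 0 is invariant under the group, for any Psi *)
  (forall Psi : 'rV[R]_4 -> R,
     invariant_pde omega_dom (fun z => Psi (omega z))) /\
  (* and every invariant equation is of this form *)
  (forall (F : 'rV[R]_11 -> R) (z0 : jet R),
     regular z0 ->
     invariant_pde (component z0) (fun z => F (jcoord z)) ->
     exists Psi : 'rV[R]_4 -> R,
       (forall z : jet R, component z0 z ->
          (F (jcoord z) = 0 <-> Psi (omega z) = 0)) /\
       ((forall z : jet R, component z0 z -> differentiable F (jcoord z)) ->
        forall z : jet R, component z0 z -> differentiable Psi (omega z))).
Proof.
split; first by move=> j i z; exact: prolong_omega.
split; first exact: differentials_free_omega.
split; first exact: local_factor.
split; first exact: component_factor.
split; first exact: omega_invariant.
exact: invariant_pde_form.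
Qed.
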